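(* Let $L,M$ be finitely generated $R$-modules. Then, for almost all $\alpha$, $\operatorname{Tor}_i^R(L,M)_\alpha\cong\operatorname{Tor}_i^{R_\alpha}(L_\alpha,M_\alpha)$ for all $i\ge 0$.
   Context: Let $k$ be an arbitrary infinite field, $u=(u_1,\ldots,u_m)$ and $x=(x_1,\ldots,x_n)$ indeterminates, and $R=k(u)[x]$. Let $K$ be an extension field of $k$; for $\alpha\in K^m$ put $R_\alpha=k(\alpha)[x]$. A property holds for almost all $\alpha$ if it holds for all $\alpha\in K^m$ except perhaps those lying on a proper algebraic subvariety of $K^m$ (which may depend on the given data). Every $a\in R$ can be written $a(u,x)=p(u,x)/q(u)$ with $p\in k[u,x]$, $q\in k[u]\setminus\{0\}$; for $\alpha$ with $q(\alpha)\neq 0$ put $a(\alpha,x)=p(\alpha,x)/q(\alpha)\in R_\alpha$. For a matrix $A=(a_{ij}(u,x))$ over $R$ put $A_\alpha=(a_{ij}(\alpha,x))$; this is defined for almost all $\alpha$. The specialization $F_\alpha$ of a free $R$-module $F$ of finite rank is a free $R_\alpha$-module of the same rank. With bases fixed, the specialization $\phi_\alpha:F_\alpha\to G_\alpha$ of a homomorphism $\phi:F\to G$ of free $R$-modules of finite ranks with matrix $A$ is the homomorphism with matrix $A_\alpha$. Each finitely generated $R$-module $L$ (including $\operatorname{Tor}_i^R(L,M)$) is considered together with a fixed (arbitrary) finite free presentation $F_1\xrightarrow{\phi}F_0\to L\to 0$ (free modules of finite ranks), and its specialization is $L_\alpha:=\operatorname{Coker}\phi_\alpha$.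
   Formalization: The fixed presentations of the Tor_i are assumed to agree for all zero modules Tor_i with i at least some i_0 (the zero module has one fixed presentation); with unrelated presentations for infinitely many zero Tor_i the claim uniform in i is false. *)

(* Defs.v *)
From HB Require Import structures.
From Stdlib Require Import ClassicalEpsilon.
From mathcomp Require Import all_boot all_order all_algebra.
From mathcomp Require Import boolp.
From mathcomp Require Import mpoly.

Set Implicit Arguments.
Unset Strict Implicit.
Unset Printing Implicit Defensive.

Import GRing.Theory.

Local Open Scope ring_scope.
Local Open Scope quotient_scope.

Definition surjective (X Y : Type) (f : X -> Y) : Prop :=
  forall y, exists x, f x = y.

Section HomologicalAlgebra.
Variable A : comNzRingType.

Definition isomorphic (U V : lmodType A) : Prop :=
  exists f : {linear U -> V}, bijective f.

Definition zero_module (U : lmodType A) : Prop := forall x : U, x = 0.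

Definition projective (P : lmodType A) : Prop :=
  forall (X Y : lmodType A) (g : {linear X -> Y}) (f : {linear P -> Y}),
    surjective g -> exists h : {linear P -> X}, forall p, g (h p) = f p.

(* exactness of X -f-> Y -g-> Z at Y *)
Definition exact_at (X Y Z : lmodType A)
    (f : {linear X -> Y}) (g : {linear Y -> Z}) : Prop :=
  forall y, g y = 0 <-> exists x, f x = y.

Record projective_resolution (L : lmodType A) := ProjectiveResolution {
  res_obj :> nat -> lmodType A;
  res_d : forall j, {linear res_obj j.+1 -> res_obj j};
  res_aug : {linear res_obj 0%N -> L};
  res_projective : forall j, projective (res_obj j);
  res_aug_surj : surjective res_aug;
  res_exact0 : exact_at (res_d 0%N) res_aug;
  res_exact : forall j, exact_at (res_d j.+1) (res_d j)
}.

(* T is the tensor product of U and V over A, with t u v the pure tensor. *)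
Definition is_tensor (U V T : lmodType A) (t : {bilinear U -> V -> T}) : Prop :=
  forall (X : lmodType A) (f : {bilinear U -> V -> X}),
    exists g : {linear T -> X}, (forall u v, g (t u v) = f u v) /\
      forall g' : {linear T -> X},
        (forall u v, g' (t u v) = f u v) -> forall x, g' x = g x.

Section Homology.
Variables (C : nat -> lmodType A) (D : forall j, {linear C j.+1 -> C j}).

Definition is_cycle (i : nat) : C i -> Prop :=
  match i return C i -> Prop with
  | 0 => fun=> True
  | j.+1 => fun z => D j z = 0
  end.

(* H is a copy of (i-cycles) / (i-boundaries): the cycles are the image of the
   monomorphism inc, and pr is the projection onto the quotient. *)
Definition is_homology (i : nat) (H : lmodType A) : Prop :=
  exists (Z : lmodType A) (inc : {linear Z -> C i}) (pr : {linear Z -> H}),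
    [/\ injective inc,
        forall z, is_cycle z <-> exists c, inc c = z,
        surjective pr &
        forall c, pr c = 0 <-> exists b, D i b = inc c].

End Homology.

(* H is a copy of Tor_i^A(L, M), i.e. the i-th homology module of P (x) M for
   a projective resolution P of L; since Tor does not depend on the choices of
   P and of the tensor products, H is determined up to isomorphism. *)
Definition is_Tor (i : nat) (L M H : lmodType A) : Prop :=
  exists (P : projective_resolution L) (C : nat -> lmodType A)
         (t : forall j, {bilinear P j -> M -> C j})
         (D : forall j, {linear C j.+1 -> C j}),
    [/\ forall j, is_tensor (t j),
        forall j x y, D j (t j.+1 x y) = t j (res_d P j x) y &
        is_homology D i H].

End HomologicalAlgebra.

(* A finite free presentation A^rels -> A^gens -> L -> 0.  Elements of free
   modules are row vectors, so the first arrow is y |-> y *m rel_mx. *)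
Record presentation (A : comNzRingType) := Presentation {
  gens : nat;
  rels : nat;
  rel_mx : 'M[A]_(rels, gens)
}.

Definition presents (A : comNzRingType) (D : presentation A) (L : lmodType A) :
    Prop :=
  exists p : {linear 'rV[A]_(gens D) -> L},
    surjective p /\ forall x, p x = 0 <-> exists y, y *m rel_mx D = x.

Section Cokernel.
Variables (A : comNzRingType) (D : presentation A).

Definition relations : {pred 'rV[A]_(gens D)} :=
  fun x => `[< exists y, y *m rel_mx D = x >].

Fact relations_submod : submod_closed relations.
Proof.
split=> [|a _ _ /asboolP[y <-] /asboolP[z <-]]; apply/asboolP.
  by exists 0; rewrite mul0mx.
by exists (a *: y + z); rewrite mulmxDl scalemxAl.
Qed.

HB.instance Definition _ :=
  GRing.isSubmodClosed.Build A 'rV[A]_(gens D) relations relations_submod.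

Definition coker : Type := Quotient.quot relations.

HB.instance Definition _ := GRing.Zmodule.on coker.

Definition coker_pi (x : 'rV[A]_(gens D)) : coker :=
  \pi_(Quotient.quot relations) x.

Definition coker_scale (a : A) (q : coker) : coker :=
  coker_pi (a *: repr (q : Quotient.quot relations)).

Fact coker_pi_eq x y : (coker_pi x = coker_pi y) <-> x - y \in relations.
Proof. by rewrite Quotient.idealrBE; split=> [/eqP|/eqP]. Qed.

Fact coker_pi_surj : surjective coker_pi.
Proof. by move=> q; exists (repr (q : Quotient.quot relations)); exact: reprK. Qed.

Fact coker_piB : zmod_morphism coker_pi.
Proof. by move=> x y; rewrite /coker_pi !piE. Qed.

HB.instance Definition _ :=
  GRing.isZmodMorphism.Build 'rV[A]_(gens D) coker coker_pi coker_piB.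

Fact coker_scaleE a x : coker_scale a (coker_pi x) = coker_pi (a *: x).
Proof.
apply/coker_pi_eq; rewrite -scalerBr rpredZ //; apply/coker_pi_eq.
exact: reprK.
Qed.

Fact coker_scaleA a b q :
  coker_scale a (coker_scale b q) = coker_scale (a * b) q.
Proof. by case: (coker_pi_surj q) => x <-; rewrite !coker_scaleE scalerA. Qed.

Fact coker_scale1 : left_id 1 coker_scale.
Proof.
by move=> q; case: (coker_pi_surj q) => x <-; rewrite coker_scaleE scale1r.
Qed.

Fact coker_scaleDr : right_distributive coker_scale +%R.
Proof.
move=> a q r; case: (coker_pi_surj q) => x <-; case: (coker_pi_surj r) => y <-.
by rewrite -raddfD !coker_scaleE scalerDr raddfD.
Qed.

Fact coker_scaleDl q : {morph coker_scale^~ q : a b / a + b}.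
Proof.
move=> a b; case: (coker_pi_surj q) => x <-.
by rewrite !coker_scaleE scalerDl raddfD.
Qed.

HB.instance Definition _ := GRing.Zmodule_isLmodule.Build A coker
  coker_scaleA coker_scale1 coker_scaleDr coker_scaleDl.

Fact coker_piZ : scalable coker_pi.
Proof. by move=> a x; rewrite -coker_scaleE. Qed.

HB.instance Definition _ :=
  GRing.isScalable.Build A 'rV[A]_(gens D) coker *:%R coker_pi coker_piZ.

Lemma presents_coker : presents D coker.
Proof.
exists coker_pi; split=> [|x]; first exact: coker_pi_surj.
rewrite -(raddf0 coker_pi); split=> [/coker_pi_eq|h].
  by rewrite subr0 => /asboolP.
by apply/coker_pi_eq; rewrite subr0; apply/asboolP.
Qed.

End Cokernel.

Section AdjoinedField.
Variables (k K : fieldType) (iota : {rmorphism k -> K}).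
Variables (m : nat) (alpha : 'I_m -> K).

(* the least subfield of K containing the image of k and all the alpha i *)
Definition adjoin_pred : {pred K} :=
  fun y => `[< forall S : {pred K}, divring_closed S ->
     (forall c, iota c \in S) -> (forall i, alpha i \in S) -> y \in S >].

Fact adjoin_divring : divring_closed adjoin_pred.
Proof.
split=> [|x y /asboolP hx /asboolP hy|x y /asboolP hx /asboolP hy];
  apply/asboolP=> S SS Sk Sa; have [S1 SB SV] := SS; first exact: S1.
- by apply: SB; [apply: hx | apply: hy].
- by apply: SV; [apply: hx | apply: hy].
Qed.

HB.instance Definition _ :=
  GRing.isDivringClosed.Build K adjoin_pred adjoin_divring.

Record adjoin : predArgType :=
  Adjoin { adjoin_val : K; adjoin_valP : adjoin_val \in adjoin_pred }.

HB.instance Definition _ := [isSub for adjoin_val].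
HB.instance Definition _ := [Choice of adjoin by <:].
HB.instance Definition _ := [SubChoice_isSubComUnitRing of adjoin by <:].
HB.instance Definition _ :=
  [SubComUnitRing_isSubIntegralDomain of adjoin by <:].
HB.instance Definition _ := [SubIntegralDomain_isSubField of adjoin by <:].

Fact adjoin_base_subproof c : iota c \in adjoin_pred.
Proof. by apply/asboolP=> S _ Sk _; apply: Sk. Qed.

Fact adjoin_gen_subproof i : alpha i \in adjoin_pred.
Proof. by apply/asboolP=> S _ _ Sa; apply: Sa. Qed.

Definition adjoin_base (c : k) : adjoin := Adjoin (adjoin_base_subproof c).
Definition adjoin_gen (i : 'I_m) : adjoin := Adjoin (adjoin_gen_subproof i).

Fact adjoin_baseB : zmod_morphism adjoin_base.
Proof. by move=> a b; apply/val_inj; rewrite /= rmorphB. Qed.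

Fact adjoin_baseM : monoid_morphism adjoin_base.
Proof.
split=> [|a b]; apply/val_inj; first by rewrite /= !rmorph1.
by rewrite /= !rmorphM.
Qed.

HB.instance Definition _ :=
  GRing.isZmodMorphism.Build k adjoin adjoin_base adjoin_baseB.
HB.instance Definition _ :=
  GRing.isMonoidMorphism.Build k adjoin adjoin_base adjoin_baseM.

(* q(alpha), computed in k(alpha) *)
Definition eval_at (q : {mpoly k[m]}) : adjoin := mmap adjoin_base adjoin_gen q.

HB.instance Definition _ :=
  GRing.RMorphism.copy eval_at (mmap adjoin_base adjoin_gen).

End AdjoinedField.

(* k(u)[x], with k[u] the polynomials in m variables *)
Notation ratpoly k m n := {mpoly {fraction {mpoly k[m]}}[n]}.

Fact eq_ratio_mpoly (B : comNzRingType) (F : fieldType) (n : nat)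
    (f : {rmorphism B -> F}) (p p' : {mpoly B[n]}) (x y : F) :
  x != 0 -> y != 0 ->
  x^-1 *: map_mpoly f p = y^-1 *: map_mpoly f p' <->
  forall mon, f p@_mon * y = f p'@_mon * x.
Proof.
move=> x0 y0; split=> [/mpolyP h mon|h].
  have := h mon; rewrite !mcoeffZ !mcoeff_map_mpoly ![_^-1 * _]mulrC => /eqP.
  by rewrite eqr_div // => /eqP.
apply/mpolyP=> mon; rewrite !mcoeffZ !mcoeff_map_mpoly ![_^-1 * _]mulrC.
by apply/eqP; rewrite eqr_div // h.
Qed.

Section Specialization.
Variables (k K : fieldType) (iota : {rmorphism k -> K}).
Variables (m n : nat) (alpha : 'I_m -> K).

Local Notation R := (ratpoly k m n).
Local Notation Ralpha := {mpoly (adjoin iota alpha)[n]}.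

(* a = p(u, x) / q(u) with q(alpha) != 0, and b = p(alpha, x) / q(alpha) *)
Definition is_specialization (a : R) (b : Ralpha) : Prop :=
  exists (p : {mpoly {mpoly k[m]}[n]}) (q : {mpoly k[m]}),
    [/\ eval_at iota alpha q != 0,
        a = (tofrac q)^-1 *: map_mpoly (@tofrac _) p &
        b = (eval_at iota alpha q)^-1 *: map_mpoly (eval_at iota alpha) p].

Lemma is_specialization_unique a b b' :
  is_specialization a b -> is_specialization a b' -> b = b'.
Proof.
move=> [p [q [q0 -> ->]]] [p' [q' [q'0 eq_a ->]]].
have nz r : eval_at iota alpha r != 0 -> tofrac r != 0.
  by rewrite tofrac_eq0; apply: contraNneq => ->; rewrite raddf0.
apply/(eq_ratio_mpoly _ _ _ q0 q'0) => mon.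
have /(_ mon) := (eq_ratio_mpoly _ _ _ (nz _ q0) (nz _ q'0)).1 eq_a.
rewrite -2!tofracM => /eqP; rewrite tofrac_eq => /eqP eq_p.
by rewrite -2!rmorphM eq_p.
Qed.

(* a(alpha, x); it is 0 when no representation of a is defined at alpha *)
Definition spec (a : R) : Ralpha := epsilon (inhabits 0) (is_specialization a).

Lemma specE a b : is_specialization a b -> spec a = b.
Proof.
by move=> ab; apply: (is_specialization_unique (epsilon_spec _ _ _)) (ab); exists b.
Qed.

Definition spec_presentation (D : presentation R) : presentation Ralpha :=
  Presentation (map_mx spec (rel_mx D)).

Definition spec_defined (D : presentation R) : Prop :=
  forall i j, exists b, is_specialization (rel_mx D i j) b.

End Specialization.

Section AlmostAll.
Variables (K : fieldType) (m : nat).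

Definition algebraic_subset (V : ('I_m -> K) -> Prop) : Prop :=
  exists S : {mpoly K[m]} -> Prop,
    forall alpha, V alpha <-> forall f, S f -> f.@[alpha] = 0.

Definition almost_all (P : ('I_m -> K) -> Prop) : Prop :=
  exists V, [/\ algebraic_subset V, exists alpha, ~ V alpha &
                forall alpha, ~ V alpha -> P alpha].

End AlmostAll.

(* Main.v *)
Require Import Defs.
From HB Require Import structures.
From mathcomp Require Import all_boot all_order all_algebra.
From mathcomp Require Import boolp.
From mathcomp Require Import mpoly.

Set Implicit Arguments.
Unset Strict Implicit.
Unset Printing Implicit Defensive.

Import GRing.Theory.
Local Open Scope ring_scope.

(* Let [Lam = k[u]].  All statements are made for matrices over [Lam[x]] and are
   required to hold at every ring morphism from [Lam] to a field that does not
   kill a suitable nonzero [q]; one such point is the embedding of [Lam] in its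
   fraction field, the others are the specializations at [alpha].  At the
   generic point an inclusion of row spaces or a product of matrices is an
   identity over [Lam[x]] after clearing denominators, hence it specializes.

   By induction on the number of variables, every row space over [Lam[x]] has a
   finite free resolution that stays exact at almost all points.  A submodule
   [Q] of [S[t]^c] is determined by the [S]-modules [X], [Y] of its elements of
   degree [< D] and [<= D] for large [D], through an exact sequence
   [0 -> S[t] (x) X -> S[t] (x) Y -> Q -> 0]; the mapping cone of the resolutions
   of [X] and [Y] over [S] resolves [Q], and the exactness of this sequence only
   rests on kernels over [S], which specialize by induction.

   A presentation of [Tor_i] then amounts to cycles generating the homology of
   the tensored resolution, and the conditions expressing this are kernel
   computations, so that they specialize too.  In degrees beyond the length of
   the resolution both sides vanish. *)

(** * Row spaces and exactness *)

(** Two obstacles shape the proof. Exactness is not an identity: the vanishing of a product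
    specializes, but a kernel can grow at special points. A condition quantified over all vectors is
    therefore transported only once a matrix is known whose rows generate the relevant kernel at the
    generic point and at almost all others. It then becomes an inclusion of row spaces, whose
    witness has one common denominator. This is why exactness at almost all points, and not only at
    the generic one, is carried through the induction. The second obstacle is that one [q] has to
    serve all degrees [i], while [generically] passes to finite conjunctions only. Finite length
    leaves finitely many exactness conditions and finitely many degrees in which [Tor] may be
    nonzero. *)

Section RowSpaces.
Variable A : comNzRingType.

(** Inclusion of row spaces, given by a witness matrix so that every ring morphism preserves it. *)
Definition factors r w c (B : 'M[A]_(r, c)) (W : 'M[A]_(w, c)) : Prop :=
  exists C, B = C *m W.

Definition exact_mx s r c (N : 'M[A]_(s, r)) (B : 'M[A]_(r, c)) : Prop :=
  N *m B = 0 /\ forall x : 'rV_r, x *m B = 0 -> factors x N.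

Lemma factors_refl r c (B : 'M[A]_(r, c)) : factors B B.
Proof. by exists 1%:M; rewrite mul1mx. Qed.

Lemma factors_mull r s w c (C : 'M[A]_(r, s)) (B : 'M_(s, c)) (W : 'M_(w, c)) :
  factors B W -> factors (C *m B) W.
Proof. by case=> D ->; exists (C *m D); rewrite mulmxA. Qed.

Lemma factors_mulr r w c e (B : 'M[A]_(r, c)) (W : 'M_(w, c)) (C : 'M_(c, e)) :
  factors B W -> factors (B *m C) (W *m C).
Proof. by case=> D ->; exists D; rewrite mulmxA. Qed.

Lemma factors_trans r s w c (B : 'M[A]_(r, c)) (V : 'M_(s, c)) (W : 'M_(w, c)) :
  factors B V -> factors V W -> factors B W.
Proof. by case=> C -> /(factors_mull C). Qed.

Lemma factorsD r w c (B B' : 'M[A]_(r, c)) (W : 'M_(w, c)) :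
  factors B W -> factors B' W -> factors (B + B') W.
Proof. by case=> C -> [D ->]; exists (C + D); rewrite mulmxDl. Qed.

Lemma factorsZ r w c a (B : 'M[A]_(r, c)) (W : 'M_(w, c)) :
  factors B W -> factors (a *: B) W.
Proof. by case=> C ->; exists (a *: C); rewrite scalemxAl. Qed.

Lemma factors_row r w c (B : 'M[A]_(r, c)) (W : 'M_(w, c)) :
  (forall i, factors (row i B) W) -> factors B W.
Proof.
move=> /choice[f fE]; exists (\matrix_i f i); apply/row_matrixP=> i.
by rewrite row_mul rowK.
Qed.

Lemma factors_rows r w c (B : 'M[A]_(r, c)) (W : 'M_(w, c)) :
  (forall x : 'rV_r, factors (x *m B) W) -> factors B W.
Proof. by move=> h; apply: factors_row => i; rewrite rowE. Qed.

Lemma factors_colu r s w c (B : 'M[A]_(r, c)) (V : 'M_(s, c)) (W : 'M_(w, c)) :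
  factors B V -> factors B (col_mx V W).
Proof. by case=> C ->; exists (row_mx C 0); rewrite mul_row_col mul0mx addr0. Qed.

Lemma factors_cold r s w c (B : 'M[A]_(r, c)) (V : 'M_(s, c)) (W : 'M_(w, c)) :
  factors B W -> factors B (col_mx V W).
Proof. by case=> C ->; exists (row_mx 0 C); rewrite mul_row_col mul0mx add0r. Qed.

Lemma factors_col_split r s c (x : 'rV[A]_c) (V : 'M_(r, c)) (W : 'M_(s, c)) :
  factors x (col_mx V W) <-> exists y z, x = y *m V + z *m W.
Proof.
split=> [[y ->]|[y [z ->]]].
  by exists (lsubmx y), (rsubmx y); rewrite -{1}[y]hsubmxK mul_row_col.
by exists (row_mx y z); rewrite mul_row_col.
Qed.

Lemma factors_unit r w c a u (B : 'M[A]_(r, c)) (W : 'M_(w, c)) :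
  u * a = 1 -> factors (a *: B) W -> factors B W.
Proof. by move=> ua /(factorsZ u); rewrite scalerA ua scale1r. Qed.

Lemma exact_mx_factors s r c t (N : 'M[A]_(s, r)) (B : 'M_(r, c)) (X : 'M_(t, r)) :
  exact_mx N B -> X *m B = 0 -> factors X N.
Proof.
move=> [_ NB] XB; apply: factors_rows => x; apply: NB.
by rewrite -mulmxA XB mulmx0.
Qed.

Lemma exact_mx_eq_left s s' r c (N : 'M[A]_(s, r)) (N' : 'M_(s', r)) (B : 'M_(r, c)) :
  exact_mx N B -> factors N N' -> factors N' N -> exact_mx N' B.
Proof.
move=> [NB0 NB] NN' [C N'N]; split; first by rewrite N'N -mulmxA NB0 mulmx0.
by move=> x /NB xN; apply: factors_trans xN NN'.
Qed.

Lemma exact_mx_eq_right s r c c' (N : 'M[A]_(s, r)) (B : 'M_(r, c)) (B' : 'M_(r, c')) :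
  (forall x : 'rV_r, x *m B = 0 <-> x *m B' = 0) -> exact_mx N B -> exact_mx N B'.
Proof.
move=> BB' [NB0 NB]; split=> [|x /BB']; last exact: NB.
apply/row_matrixP=> i; rewrite row_mul row0; apply/BB'.
by rewrite -row_mul NB0 row0.
Qed.

Definition submodule (U : lmodType A) (Q : U -> Prop) : Prop :=
  Q 0 /\ forall a x y, Q x -> Q y -> Q (a *: x + y).

Lemma submoduleD (U : lmodType A) (Q : U -> Prop) x y :
  submodule Q -> Q x -> Q y -> Q (x + y).
Proof. by move=> [_ Qlin] Qx Qy; rewrite -[x]scale1r; apply: Qlin. Qed.

Lemma submoduleZ (U : lmodType A) (Q : U -> Prop) a x :
  submodule Q -> Q x -> Q (a *: x).
Proof. by move=> [Q0 Qlin] Qx; rewrite -[_ *: x]addr0; apply: Qlin. Qed.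

Lemma submodule_mulmx s c (Q : 'rV[A]_c -> Prop) (y : 'rV_s) (F : 'M_(s, c)) :
  submodule Q -> (forall i, Q (row i F)) -> Q (y *m F).
Proof.
move=> subQ QF; rewrite mulmx_sum_row.
by apply: (big_ind Q) => [|u v|i _]; [case: subQ | exact: submoduleD | exact: submoduleZ].
Qed.

Lemma factors_submodule r c (B : 'M[A]_(r, c)) :
  submodule (fun v : 'rV_c => factors v B).
Proof.
split=> [|a x y xB yB]; first by exists 0; rewrite mul0mx.
by apply: factorsD => //; apply: factorsZ.
Qed.

Definition noetherian : Prop :=
  forall c (Q : 'rV[A]_c -> Prop), submodule Q ->
    exists s (W : 'M_(s, c)), forall v, Q v <-> factors v W.

End RowSpaces.

Lemma factors_map (A B : comNzRingType) (f : {rmorphism A -> B}) r w c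
    (M : 'M[A]_(r, c)) (W : 'M_(w, c)) :
  factors M W -> factors (map_mx f M) (map_mx f W).
Proof. by case=> C ->; exists (map_mx f C); rewrite map_mxM. Qed.

(** A matrix of maximal rank among those with row space in [Q] generates [Q], since adjoining a
    vector of [Q] cannot raise the rank. *)
Lemma field_noetherian (F : fieldType) : noetherian F.
Proof.
move=> c Q [Q0 Qlin].
pose P k := `[< exists s (W : 'M[F]_(s, c)), (forall v, factors v W -> Q v) /\ \rank W = k >].
have exP : exists k, P k.
  exists 0%N; apply/asboolP; exists 0%N, 0; split; last exact: mxrank0.
  by move=> v [C ->]; rewrite mulmx0.
have ubP k : P k -> (k <= c)%N.
  by move=> /asboolP[s [W [_ <-]]]; exact: rank_leq_col.
case: (ex_maxnP exP ubP) => k /asboolP[s [W [WQ Wk]]] kmax.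
exists s, W => v; split=> [Qv|]; last exact: WQ.
have /kmax : P (\rank (col_mx v W)).
  apply/asboolP; exists (1 + s)%N, (col_mx v W); split=> // x.
  case/factors_col_split=> y [z ->].
  rewrite [y]mx11_scalar mul_scalar_mx; apply: Qlin => //.
  by apply: WQ; exists z.
rewrite -Wk -addsmxE => le_rank.
suff /submxP[C ->] : (v <= W)%MS by exists C.
have : (W == v + W)%MS.
  by rewrite -(mxrank_leqif_eq (addsmxSr _ _)) eqn_leq le_rank mxrankS // addsmxSr.
by case/andP=> _; apply: submx_trans; exact: addsmxSl.
Qed.

(** * Families of rings and generic properties *)

Section Families.
Variable Lam : idomainType.

(** The target field belongs to the point because each [alpha] has its own field [k(alpha)]. *)
Record point := Point {
  pt_field : fieldType;
  pt_map : {rmorphism Lam -> pt_field}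
}.

Definition generic_pt : point := Point (@tofrac Lam : {rmorphism _ -> _}).

Definition generically (P : point -> Prop) : Prop :=
  exists2 q, q != 0 & forall p, pt_map p q != 0 -> P p.

Lemma generically_all (P : point -> Prop) : (forall p, P p) -> generically P.
Proof. by exists 1; rewrite ?oner_neq0. Qed.

Lemma generically_imp (P P' : point -> Prop) :
  (forall p, P p -> P' p) -> generically P -> generically P'.
Proof. by move=> PP' [q q0 Pq]; exists q => // p /Pq/PP'. Qed.

Lemma generically_and (P P' : point -> Prop) :
  generically P -> generically P' -> generically (fun p => P p /\ P' p).
Proof.
move=> [q q0 Pq] [q' q'0 Pq']; exists (q * q'); first exact: mulf_neq0.
by move=> p; rewrite rmorphM mulf_eq0 negb_or => /andP[/Pq ? /Pq'].
Qed.

Lemma generically_neq0 q : q != 0 -> generically (fun p => pt_map p q != 0).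
Proof. by exists q. Qed.

Lemma generically_forall n (P : nat -> point -> Prop) :
  (forall i, (i < n)%N -> generically (P i)) ->
  generically (fun p => forall i, (i < n)%N -> P i p).
Proof.
elim: n => [|n IHn] h; first by apply: generically_all => p i.
have := generically_and (h n (ltnSn n)) (IHn (fun i lt_in => h i (ltnW lt_in))).
apply: generically_imp => p [Pn Plt] i; rewrite ltnS leq_eqVlt.
by case/orP=> [/eqP->|/Plt].
Qed.

(** The embedding in the fraction field kills no nonzero [q], hence it is one of the points at which
    a generic property holds. *)
Lemma generically_generic (P : point -> Prop) : generically P -> P generic_pt.
Proof. by case=> q q0; apply; rewrite tofrac_eq0. Qed.

(** A [Lam]-algebra with a fibre over each point; that this notion is stable under adjoining a
    variable makes the induction possible. By [fam_unit], a scalar not killed at a point is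
    invertible in the fibre. By [fam_inj] and [fam_clear], the generic fibre is the localization of
    the ring at the nonzero scalars. *)
Record ringfam := RingFam {
  fam_ring :> comNzRingType;
  fam_fib : point -> comNzRingType;
  fam_ev : forall p, {rmorphism fam_ring -> fam_fib p};
  fam_cst : {rmorphism Lam -> fam_ring};
  fam_unit : forall p q, pt_map p q != 0 ->
    exists u, u * fam_ev p (fam_cst q) = 1;
  fam_inj : injective (fam_ev generic_pt);
  fam_clear : forall y, exists2 q, q != 0 &
    exists x, fam_ev generic_pt x = fam_ev generic_pt (fam_cst q) * y
}.

Section OneFamily.
Variable X : ringfam.
Local Notation "B @ p" := (map_mx (fam_ev X p) B) (at level 30).
Local Notation "q %:X" := (fam_cst X q) (at level 2, format "q %:X").

Lemma clear_mx r c (Y : 'M[fam_fib X generic_pt]_(r, c)) : exists2 q, q != 0 &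
  exists B : 'M[X]_(r, c), B@generic_pt = fam_ev X generic_pt q%:X *: Y.
Proof.
pose ok (i : 'I_r * 'I_c) (qx : Lam * X) := qx.1 != 0 /\
  fam_ev X generic_pt qx.2 = fam_ev X generic_pt qx.1%:X * Y i.1 i.2.
have /choice[f fok] : forall i, exists qx, ok i qx.
  by move=> i; have [q q0 [x xE]] := fam_clear (Y i.1 i.2); exists (q, x).
exists (\prod_i (f i).1).
  by apply/prodf_neq0 => i _; have [] := fok i.
(* The denominators of the other entries bring the entry [(i, j)] to the common denominator. *)
exists (\matrix_(i, j) ((\prod_(l | l != (i, j)) (f l).1)%:X * (f (i, j)).2)).
apply/matrixP=> i j; rewrite !mxE rmorphM /= (fok (i, j)).2 /=.
by rewrite [in RHS](bigD1 (i, j)) //= !rmorphM /= mulrCA mulrA.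
Qed.

Lemma map_generic_inj r c (B B' : 'M[X]_(r, c)) :
  B@generic_pt = B'@generic_pt -> B = B'.
Proof.
move=> /matrixP BB'; apply/matrixP=> i j; apply: (@fam_inj X).
by have := BB' i j; rewrite !mxE.
Qed.

Lemma factors_clear r w c (B : 'M[X]_(r, c)) (W : 'M_(w, c)) :
  factors (B@generic_pt) (W@generic_pt) ->
  exists2 q, q != 0 & exists C, q%:X *: B = C *m W.
Proof.
case=> C BCW; have [q q0 [C' C'E]] := clear_mx C; exists q => //; exists C'.
by apply: map_generic_inj; rewrite map_mxZ map_mxM C'E BCW scalemxAl.
Qed.

Lemma factors_fibre r w c (B : 'M[X]_(r, c)) (W : 'M_(w, c)) q p :
  pt_map p q != 0 -> factors (q%:X *: B) W -> factors (B@p) (W@p).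
Proof.
move=> pq [C BCW]; have [u uq] := fam_unit X pq; apply: factors_unit uq _.
by exists (C@p); rewrite -map_mxZ BCW map_mxM.
Qed.

(** The witness at the generic point has a common denominator; the cleared identity holds over the
    ring itself and passes to every fibre in which that denominator is invertible. *)
Lemma factors_generically r w c (B : 'M[X]_(r, c)) (W : 'M_(w, c)) :
  factors (B@generic_pt) (W@generic_pt) ->
  generically (fun p => factors (B@p) (W@p)).
Proof. by move=> /factors_clear[q q0 BW]; exists q => // p pq; apply: factors_fibre pq BW. Qed.

(** A free resolution of the row space of [B] by matrices over the total ring, the same for all
    fibres. The number [d] counts the syzygy matrices after [B]; the last matrix of the chain has no
    kernel at almost all points. *)
Fixpoint resolved (d : nat) r c (B : 'M[X]_(r, c)) : Prop :=
  if d is d'.+1 then exists s (N : 'M[X]_(s, r)),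
    generically (fun p => exact_mx (N@p) (B@p)) /\ resolved d' N
  else generically (fun p => forall x : 'rV_r, x *m B@p = 0 -> x = 0).

Lemma resolvedS d r c (B : 'M[X]_(r, c)) : resolved d B -> resolved d.+1 B.
Proof.
elim: d r c B => [|d IHd] r c B.
  move=> injB; exists 0%N, 0; split.
    apply: generically_imp injB => p injB; split; first exact: flatmx0.
    by move=> x /injB->; exists 0; rewrite mul0mx.
  by apply: generically_all => p x _; rewrite thinmx0.
by case=> s [N [NB /IHd resN]]; exists s, N.
Qed.

Lemma resolved_leq d e r c (B : 'M[X]_(r, c)) :
  (d <= e)%N -> resolved d B -> resolved e B.
Proof.
by move=> /subnK <-; elim: (e - d)%N => // n IHn /IHn/resolvedS.
Qed.

Lemma resolved_scale d q r c (B : 'M[X]_(r, c)) :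
  q != 0 -> resolved d B -> resolved d (q%:X *: B).
Proof.
move=> q0; have kerE p (x : 'rV_r) : pt_map p q != 0 ->
    x *m B@p = 0 <-> x *m (q%:X *: B)@p = 0.
  move=> pq; have [u uq] := fam_unit X pq.
  rewrite map_mxZ -scalemxAr; split=> [->|/(congr1 ( *:%R u))]; first exact: scaler0.
  by rewrite scalerA uq scale1r scaler0.
case: d => [|d] /=.
  move=> /(generically_and (generically_neq0 q0)); apply: generically_imp => p [pq h] x.
  by move/(kerE _ _ pq)/h.
case=> s [N [NB resN]]; exists s, N; split=> //.
move: NB => /(generically_and (generically_neq0 q0)); apply: generically_imp => p [pq].
by apply: exact_mx_eq_right => x; apply: kerE.
Qed.

(* The mapping cone of a morphism of resolutions, one degree at a time: the
   hypothesis on [P] and [f] is what lifts [f] to the next degree. *)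
Lemma resolved_cone d a1 a0 b1 b0 (P : 'M[X]_(a1, a0)) (Q : 'M[X]_(b1, b0))
    (f : 'M[X]_(a1, b0)) :
  resolved d P -> resolved d Q ->
  generically (fun p => forall x : 'rV_a1, x *m P@p = 0 -> factors (x *m f@p) (Q@p)) ->
  resolved d (block_mx P f 0 Q).
Proof.
elim: d a1 a0 b1 b0 P Q f => [|d IHd] a1 a0 b1 b0 P Q f /=.
  move=> injP injQ _; apply: generically_imp (generically_and injP injQ) => p [{}injP {}injQ] x.
  rewrite map_block_mx map_mx0 -[x]hsubmxK mul_row_block mulmx0 addr0 -row_mx0.
  case/eq_row_mx=> /injP->; rewrite mul0mx add0r => /injQ->.
  by rewrite row_mx0.
case=> s [P' [exP resP']] [t [Q' [exQ resQ']]] Pf.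
(* Over the ring itself [f] lifts only up to a scalar [q], so [q P'] replaces [P'] in the next
   block; where [q] is invertible, this changes no row space. *)
have /factors_clear[q q0 [f' f'E]] : factors ((P' *m f)@generic_pt) (Q@generic_pt).
  have [P'P _] := generically_generic exP.
  rewrite map_mxM; apply: factors_rows => x; rewrite mulmxA.
  by apply: (generically_generic Pf); rewrite -mulmxA P'P mulmx0.
exists (s + t)%N, (block_mx (q%:X *: P') (- f') 0 Q'); split; last first.
  apply: IHd => //; first exact: resolved_scale.
  have := generically_and (generically_neq0 q0) (generically_and exP exQ).
  apply: generically_imp => p [pq [_ [_ exQ']]] x.
  rewrite map_mxZ -scalemxAr => xP'; apply: exQ'.
  rewrite map_mxN mulmxN mulNmx -mulmxA -map_mxM -f'E map_mxZ map_mxM -scalemxAr.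
  by rewrite mulmxA scalemxAl xP' mul0mx oppr0.
have := generically_and (generically_neq0 q0) (generically_and exP (generically_and exQ Pf)).
apply: generically_imp => p [pq [[P'P exP'] [[Q'Q exQ'] _]]].
have [u uq] := fam_unit X pq.
have f'p : f'@p *m Q@p = fam_ev X p q%:X *: (P'@p *m f@p).
  by rewrite -!map_mxM -f'E map_mxZ.
rewrite !map_block_mx !map_mx0 map_mxN map_mxZ; split.
  rewrite mulmx_block !mulmx0 !mul0mx !addr0 add0r -!scalemxAl P'P Q'Q scaler0.
  by rewrite mulNmx f'p subrr block_mx0.
move=> x; rewrite -[x]hsubmxK; move: (lsubmx x) (rsubmx x) => {x} x y.
rewrite mul_row_block mulmx0 addr0 -row_mx0 => /eq_row_mx[xP xfyQ].
have [x' x'E] := exP' _ xP.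
have /exQ'[y' y'E] : (y + u *: (x' *m f'@p)) *m Q@p = 0.
  rewrite mulmxDl -scalemxAl -mulmxA f'p -scalemxAr scalerA uq scale1r addrC.
  by rewrite mulmxA -x'E.
exists (row_mx (u *: x') y'); rewrite mul_row_block mulmx0 addr0; congr row_mx.
  by rewrite -scalemxAl -scalemxAr scalerA uq scale1r.
by rewrite -y'E mulmxN -scalemxAl addrC addrK.
Qed.

(** A row space is resolved after a change of generators from [B] to [W], so that each construction
    may use the generators that suit it. Noetherianity concerns the generic fibre, where generators
    are found before denominators are cleared. *)
Definition syzygetic : Prop :=
  noetherian (fam_fib X generic_pt) /\
  forall r c (B : 'M[X]_(r, c)), exists w (W : 'M[X]_(w, c)) d,
    generically (fun p => factors (B@p) (W@p) /\ factors (W@p) (B@p)) /\ resolved d W.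

(** If [B = C W] and [W = C' B], a relation [x] of [B] equals [x (1 - C C') + (x C) C'], where [x C]
    is a relation of [W]. Hence the rows of [1 - C C'] and [N C'] generate the relations of [B]; [q]
    and [q'] account for cleared denominators. *)
Lemma syzygetic_ker : syzygetic -> forall r c (B : 'M[X]_(r, c)),
  exists s (N : 'M[X]_(s, r)), generically (fun p => exact_mx (N@p) (B@p)).
Proof.
move=> [_ syz] r c B; have [w [W [d [BW /resolvedS[s [N [exN _]]]]]]] := syz r c B.
have [/factors_clear[q q0 [C CE]] /factors_clear[q' q'0 [C' C'E]]] := generically_generic BW.
exists (r + s)%N, (col_mx ((q' * q)%:X%:M - C *m C') (N *m C')).
have qq0 : q' * q != 0 by apply: mulf_neq0.
apply: generically_imp (generically_and (generically_neq0 qq0) exN) => p [pq [NW exNp]].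
have [u uq] := fam_unit X pq; split.
  rewrite -map_mxM mul_col_mx mulmxBl -!mulmxA -C'E -scalemxAr -CE.
  rewrite mul_scalar_mx scalerA -rmorphM subrr -scalemxAr map_col_mx map_mx0 map_mxZ.
  by rewrite map_mxM NW scaler0 col_mx0.
move=> x xB.
have /exNp[y yE] : (x *m C@p) *m W@p = 0.
  by rewrite -mulmxA -map_mxM -CE map_mxZ -scalemxAr xB scaler0.
apply: factors_unit uq _; rewrite map_col_mx; apply/factors_col_split.
exists x, y.
rewrite map_mxB map_scalar_mx !map_mxM mulmxBr mul_mx_scalar !mulmxA yE -!mulmxA.
by rewrite subrK.
Qed.

End OneFamily.

Fact base_unit p q : pt_map p q != 0 -> exists u, u * pt_map p (idfun q) = 1.
Proof. by exists (pt_map p q)^-1; rewrite mulVf. Qed.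

Fact base_inj : injective (pt_map generic_pt).
Proof. by move=> x y /eqP; rewrite /= tofrac_eq => /eqP. Qed.

Fact base_clear y : exists2 q, q != 0 &
  exists x, pt_map generic_pt x = pt_map generic_pt (idfun q) * y.
Proof.
case: (repr y) (reprK y) => r r_dom <-; exists r.2 => //; exists r.1 => /=.
unlock tofrac; rewrite -[RHS]FracField.pi_mul; apply/eqmodP.
rewrite /= /FracField.equivf /FracField.mulf !numden_Ratio ?mul1r ?oner_eq0 //=.
by rewrite mulrC.
Qed.

Definition base_family : ringfam :=
  @RingFam Lam (fun p => pt_field p) pt_map idfun base_unit base_inj base_clear.

Lemma base_syzygetic : syzygetic base_family.
Proof.
split=> [|r c B]; first exact: field_noetherian.
have [q q0 [W WE]] := @clear_mx base_family _ _ (row_base (map_mx (pt_map generic_pt) B)).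
have qF : pt_map generic_pt q != 0 by rewrite tofrac_eq0.
exists _, W, 0%N; split.
  apply: generically_and; apply: factors_generically; rewrite ?WE.
    apply: (@factors_unit _ _ _ _ (pt_map generic_pt q) (pt_map generic_pt q)^-1).
      exact: mulVf.
    exists (col_base (map_mx (pt_map generic_pt) B)).
    by rewrite -scalemxAr mulmx_base.
  apply: factorsZ; set B' := map_mx _ B.
  have /submxP[C CE] : (row_base B' <= B')%MS by rewrite eq_row_base.
  by exists C.
(* A right inverse of the basis, cleared of denominators, expresses the independence of its rows by
   the identity [W V' = q q'], which specializes. *)
have /row_freeP[V VE] := row_base_free (map_mx (pt_map generic_pt) B).
have [q' q'0 [V' V'E]] := @clear_mx base_family _ _ V.
have WV : W *m V' = (q * q')%:M.
  apply: (@map_generic_inj base_family); rewrite map_mxM WE V'E -scalemxAl -scalemxAr VE.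
  by rewrite scalerA map_scalar_mx rmorphM scalemx1.
have : generically (fun p => pt_map p (q * q') != 0).
  by apply: generically_neq0; apply: mulf_neq0.
apply: generically_imp => p pqq x xW.
have : x *m map_mx (pt_map p) (W *m V') = 0 by rewrite map_mxM mulmxA xW mul0mx.
rewrite WV map_scalar_mx mul_mx_scalar => /eqP; rewrite scaler_eq0 (negPf pqq).
by move/eqP.
Qed.

End Families.

(** * Adjoining a variable *)

Notation pc := (map_mx polyC).
Notation cf j := (map_mx (coefp j)).

Section PolyMatrices.
Variable A : comNzRingType.
Implicit Types (r s c d j : nat).

Lemma cf_pc_mul j r s c (N : 'M[A]_(r, s)) (W : 'M[{poly A}]_(s, c)) :
  cf j (pc N *m W) = N *m cf j W.
Proof.
apply/matrixP=> i l; rewrite !mxE /= coef_sum.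
by apply: eq_bigr => h _; rewrite !mxE /= coefCM.
Qed.

Lemma cf_mul_pc j r s c (W : 'M[{poly A}]_(r, s)) (N : 'M[A]_(s, c)) :
  cf j (W *m pc N) = cf j W *m N.
Proof.
apply/matrixP=> i l; rewrite !mxE /= coef_sum.
by apply: eq_bigr => h _; rewrite !mxE /= coefMC.
Qed.

Lemma cf_pc j r c (N : 'M[A]_(r, c)) : cf j (pc N) = if j is 0 then N else 0.
Proof.
by apply/matrixP=> i l; rewrite !mxE /= coefC; case: j => [|j] //=; rewrite mxE.
Qed.

Lemma cf_scaleXn j d r c (W : 'M[{poly A}]_(r, c)) :
  cf j ('X^d *: W) = if (j < d)%N then 0 else cf (j - d) W.
Proof.
by apply/matrixP=> i l; rewrite !mxE /= coefXnM; case: ifP; rewrite mxE.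
Qed.

Lemma cf_scaleXn_pc j d r c (N : 'M[A]_(r, c)) :
  cf j ('X^d *: pc N) = if j == d then N else 0.
Proof.
rewrite cf_scaleXn cf_pc; case: ltngtP => [//|lt_dj|->]; last by rewrite subnn.
by case: (j - d)%N (subn_gt0 d j) => //; rewrite lt_dj.
Qed.

Lemma cfB j r c (V W : 'M[{poly A}]_(r, c)) : cf j (V - W) = cf j V - cf j W.
Proof. by apply/matrixP=> i l; rewrite !mxE /= coefB. Qed.

Lemma cf_eq0 r c (W : 'M[{poly A}]_(r, c)) : (forall j, cf j W = 0) -> W = 0.
Proof.
move=> W0; apply/matrixP=> i l; apply/polyP=> j.
by have /matrixP/(_ i l) := W0 j; rewrite !mxE /= coef0.
Qed.

Lemma cf_bound r c (W : 'M[{poly A}]_(r, c)) :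
  exists d, forall j, (d <= j)%N -> cf j W = 0.
Proof.
exists (\max_i \max_l size (W i l)) => j le_dj; apply/matrixP=> i l; rewrite !mxE /=.
rewrite nth_default //; apply: leq_trans le_dj.
exact: leq_trans (leq_bigmax l) (leq_bigmax (F := fun i => \max_l size (W i l)) i).
Qed.

Lemma cf_mul_top r s c J D (V : 'M[{poly A}]_(r, s)) (W : 'M[{poly A}]_(s, c)) :
  (forall j, (J < j)%N -> cf j V = 0) -> (forall j, (D < j)%N -> cf j W = 0) ->
  cf (J + D) (V *m W) = cf J V *m cf D W.
Proof.
move=> VJ WD; apply/matrixP=> i l; rewrite !mxE /= coef_sum.
apply: eq_bigr => h _; rewrite !mxE /= coefM.
have lt_J : (J < (J + D).+1)%N by rewrite ltnS leq_addr.
rewrite (bigD1 (Ordinal lt_J)) //= addKn big1 ?addr0 // => k neq_kJ.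
have [lt_Jk|] := ltnP J k.
  by have /matrixP/(_ i h) := VJ k lt_Jk; rewrite !mxE /= => ->; rewrite mul0r.
rewrite leq_eqVlt => /orP[/eqP eq_kJ|lt_kJ].
  by case/eqP: neq_kJ; apply: val_inj.
have lt_D : (D < J + D - k)%N by rewrite ltn_subRL ltn_add2r.
by have /matrixP/(_ h l) := WD _ lt_D; rewrite !mxE /= => ->; rewrite mulr0.
Qed.

Lemma pc_scaleX_ind c (P : 'rV[{poly A}]_c -> Prop) :
  P 0 -> (forall x y, P x -> P ('X *: x + pc y)) -> forall x, P x.
Proof.
move=> P0 PS x; have [d] := cf_bound x.
elim: d x => [|d IHd] x xd; first by rewrite [x]cf_eq0 // => j; exact: xd.
pose x' := \row_i \poly_(j < d) (x 0 i)`_j.+1.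
have -> : x = 'X *: x' + pc (cf 0 x).
  apply/rowP=> i; rewrite !mxE; apply/polyP=> -[|j] /=.
    by rewrite coefD coefXM coefC add0r.
  rewrite coefD coefXM coefC addr0 /= coef_poly; case: ltnP => // le_dj.
  by have /rowP/(_ i) := xd j.+1 le_dj; rewrite !mxE.
apply: PS; apply: IHd => j le_dj; apply/rowP=> i; rewrite !mxE /= coef_poly.
by rewrite ltnNge le_dj.
Qed.

(* Row vectors over [A] of length [d * c] encode, through multiplication by
   this matrix, the row vectors of polynomials of degree less than [d]. *)
Definition Xmx c d : 'M[{poly A}]_(\sum_(j < d) c, c) :=
  \mxcol_(j < d) ('X^j)%:M.

Lemma pc_Xmx r c d (N : 'M[A]_(r, \sum_(j < d) c)) :
  pc N *m Xmx c d = \sum_(j < d) 'X^j *: pc (submxrow N j).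
Proof.
rewrite -[pc N]submxrowK mul_mxrow_mxcol; apply: eq_bigr => j _.
by rewrite mul_mx_scalar; congr (_ *: _); apply/matrixP=> i l; rewrite !mxE.
Qed.

Lemma cf_pc_Xmx r c d (N : 'M[A]_(r, \sum_(j < d) c)) j :
  cf j (pc N *m Xmx c d) = if insub j is Some i then submxrow N i else 0.
Proof.
rewrite pc_Xmx raddf_sum /=.
under eq_bigr => i _ do rewrite cf_scaleXn_pc.
case: insubP => [i lt_jd ij|ge_jd].
  rewrite (bigD1 i) //= ij eqxx big1 ?addr0 // => k neq_ki.
  by case: eqP => // jk; case/eqP: neq_ki; apply: val_inj; rewrite /= -jk.
rewrite big1 // => k _; case: eqP => // jk.
by case/negP: ge_jd; rewrite jk.
Qed.

Lemma pc_Xmx_deg r c d (N : 'M[A]_(r, \sum_(j < d) c)) j :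
  (d <= j)%N -> cf j (pc N *m Xmx c d) = 0.
Proof. by move=> le_dj; rewrite cf_pc_Xmx insubF // ltnNge le_dj. Qed.

Lemma pc_Xmx_eq0 r c d (N : 'M[A]_(r, \sum_(j < d) c)) :
  pc N *m Xmx c d = 0 -> N = 0.
Proof.
move=> N0; apply/mxrowP=> j; rewrite submxrow0.
have := cf_pc_Xmx N j; rewrite valK N0 => <-.
by apply/matrixP=> i l; rewrite !mxE /= coef0.
Qed.

Lemma pc_Xmx_surj r c d (W : 'M[{poly A}]_(r, c)) :
  (forall j, (d <= j)%N -> cf j W = 0) ->
  exists N, W = pc N *m Xmx c d.
Proof.
move=> Wd; exists (\mxrow_(j < d) cf j W); apply/eqP; rewrite -subr_eq0; apply/eqP.
apply: cf_eq0 => j; rewrite cfB cf_pc_Xmx; case: insubP => [i _ <-|ge_jd].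
  by rewrite mxrowK subrr.
by rewrite subr0 Wd // leqNgt.
Qed.

(** Flatness of [A[t]] over [A]: a polynomial vector is killed by a constant matrix exactly when
    each of its coefficients is. *)
Lemma pc_exact s r c (N : 'M[A]_(s, r)) (B : 'M[A]_(r, c)) :
  exact_mx N B -> exact_mx (pc N) (pc B).
Proof.
move=> [NB0 NB]; split; first by rewrite -map_mxM NB0 map_mx0.
elim/pc_scaleX_ind=> [_|x y IHx xB]; first by exists 0; rewrite mul0mx.
have cfE j : cf j ('X *: (x *m pc B) + pc (y *m B)) = 0.
  rewrite scalemxAl map_mxM -mulmxDl xB; apply/matrixP=> i l.
  by rewrite !mxE /= coef0.
have {cfE}[xB0 yB0] : x *m pc B = 0 /\ y *m B = 0.
  have cfE' j : cf j ('X^1 *: (x *m pc B)) = - cf j (pc (y *m B)).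
    apply/eqP; rewrite -addr_eq0; apply/eqP; rewrite -[RHS](cfE j).
    by apply/matrixP=> i l; rewrite !mxE /= coefD.
  split; first apply: cf_eq0 => j.
    by have := cfE' j.+1; rewrite cf_scaleXn subn1 cf_pc oppr0.
  by have /eqP := cfE' 0; rewrite cf_scaleXn cf_pc eq_sym oppr_eq0 => /eqP.
apply: factorsD; first by apply: factorsZ; apply: IHx.
exact/factors_map/NB.
Qed.

End PolyMatrices.

(* The rows of [WX] and [WY] generate, as [A]-modules, the parts [X] and [Y] of
   degree [< D] and [<= D] of the row space of [WY].  The exact sequence is
   [0 -> A[t] (x) X -> A[t] (x) Y -> im WY -> 0], with first map
   [t (x) 1 - 1 (x) t], given (up to the unit [q]) by [Z]. *)
Section FilteredRowSpace.
Variables (A : comNzRingType) (c D gx gy k ax ay : nat).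
Variables (NX : 'M[A]_(gx, \sum_(j < D) c)) (NY : 'M[A]_(gy, \sum_(j < D.+1) c)).
Variables (I T : 'M[A]_(gx, gy)) (K : 'M[A]_(k, gy)).
Variables (AX : 'M[A]_(ax, gx)) (AY : 'M[A]_(ay, gy)) (q u : A).
Let WX := pc NX *m Xmx A c D.
Let WY := pc NY *m Xmx A c D.+1.
Let Z : 'M[{poly A}]_(gx, gy) := 'X *: pc I - pc T.
Hypothesis uq : u * q = 1.
(** Up to [q], the matrix [I] represents the inclusion of [X] in [Y], and [T] the multiplication by
    [t] from [X] to [Y]. The rows of [K] generate the combinations of generators of [Y] that have no
    term of degree [D]; [KE] places these in [X]. *)
Hypothesis IE : q%:P *: WX = pc I *m WY.
Hypothesis TE : q%:P *: ('X *: WX) = pc T *m WY.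
Hypothesis exK : exact_mx K (cf D WY).
Hypothesis KE : exists U, pc K *m WY = pc U *m WX.
Hypotheses (exX : exact_mx AX NX) (exY : exact_mx AY NY).

Fact pc_factors_WY r (y : 'M[A]_(r, gy)) : pc y *m WY = 0 -> factors y AY.
Proof.
move=> yW; apply: exact_mx_factors exY _; apply: (@pc_Xmx_eq0 A _ c D.+1).
by rewrite map_mxM -mulmxA.
Qed.

Fact cfZ j : cf j Z = if j is 0 then - T else if j is 1 then I else 0.
Proof.
rewrite /Z cfB cf_pc -['X]expr1 cf_scaleXn_pc.
by case: j => [|[|j]] /=; rewrite ?subr0 ?sub0r.
Qed.

Fact Z_WY : Z *m WY = 0.
Proof. by rewrite mulmxBl -scalemxAl -IE -TE !scalerA mulrC subrr. Qed.

(** Induction on the degree of [x]. The top coefficient of a relation represents an element of [Y]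
    without term of degree [D], hence an element of [X]. Modulo the rows of [Z], its product with a
    power of [t] is traded for its image under [T] times the preceding power. A constant relation is
    a relation of [NY]. *)
Lemma filtered_exact_generators : exact_mx (col_mx Z (pc AY)) WY.
Proof.
split.
  by rewrite mul_col_mx Z_WY mulmxA -map_mxM exY.1 map_mx0 mul0mx col_mx0.
move=> x; have [e] := cf_bound x; elim: e x => [|J IHJ] x xe xW.
  by rewrite [x]cf_eq0 => [|j]; [exists 0; rewrite mul0mx | apply: xe].
have [z zE] : factors (cf J x) K.
  apply: exact_mx_factors exK _; rewrite -cf_mul_top ?xW //.
    by apply/matrixP=> i l; rewrite !mxE /= coef0.
  by move=> j; apply: pc_Xmx_deg.
(* The vector [y] represents in [X] the element that [cf J x] represents in [Y]; the difference [r]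
   represents zero in [Y]. *)
have [U UE] := KE; pose y := u *: (z *m U); pose r := cf J x - y *m I.
have yW : pc y *m WX = u%:P *: (pc (cf J x) *m WY).
  by rewrite zE map_mxZ !map_mxM -scalemxAl -!mulmxA UE.
have [s rE] : factors r AY.
  apply: pc_factors_WY; rewrite map_mxB map_mxM mulmxBl -mulmxA -IE -scalemxAr yW.
  by rewrite scalerA -rmorphM mulrC uq scale1r subrr.
case: J => [|J] in IHJ xe zE r yW s rE *.
  have xE : x = pc (cf 0 x).
    apply/eqP; rewrite -subr_eq0; apply/eqP/cf_eq0 => -[|j].
      by rewrite cfB cf_pc subrr.
    by rewrite cfB cf_pc subr0 xe.
  apply: factors_cold; rewrite xE; apply: factors_map; apply: pc_factors_WY.
  by rewrite -xE.
have rf : factors ('X^J *: (pc y *m Z) + 'X^(J.+1) *: pc r) (col_mx Z (pc AY)).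
  apply: factorsD; apply: factorsZ.
    by apply: factors_colu; apply: factors_mull; apply: factors_refl.
  by apply: factors_cold; apply: factors_map; exists s.
rewrite -[x](subrK ('X^J *: (pc y *m Z) + 'X^(J.+1) *: pc r)).
apply: factorsD => //; apply: IHJ => [j le_Jj|].
  have -> : 'X^J *: (pc y *m Z) + 'X^(J.+1) *: pc r =
      'X^(J.+1) *: pc (cf J.+1 x) - 'X^J *: pc (y *m T).
    rewrite /Z /r mulmxBr -scalemxAr map_mxB !scalerBr scalerA -exprSr -!map_mxM.
    by rewrite addrC addrA subrK.
  rewrite !cfB !cf_scaleXn_pc [j == J]gtn_eqF // subr0.
  by case: eqP => [->|/eqP neq_j]; rewrite ?subrr // subr0 xe // ltn_neqAle eq_sym neq_j.
rewrite mulmxBl xW mulmxDl -!scalemxAl -mulmxA Z_WY mulmx0 scaler0 add0r.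
by rewrite rE map_mxM -mulmxA [pc AY *m _]mulmxA -map_mxM exY.1 map_mx0 mul0mx mulmx0 scaler0 addr0
  oppr0.
Qed.

(** The first map of the exact sequence respects the relations of [X], since the rows of [AX I] and
    of [AX T] are killed by [WY]. *)
Lemma filtered_relations_compat : factors (pc AX *m Z) (pc AY).
Proof.
have AXW : pc AX *m WX = 0 by rewrite mulmxA -map_mxM exX.1 map_mx0 mul0mx.
rewrite mulmxBr -scalemxAr -!map_mxM -scaleN1r.
apply: factorsD; apply: factorsZ; apply: factors_map; apply: pc_factors_WY;
  rewrite map_mxM -mulmxA.
  by rewrite -IE -scalemxAr AXW scaler0.
by rewrite -TE -!scalemxAr AXW !scaler0.
Qed.

(** Injectivity of the first map: the top coefficient of [x Z] is that of [x] times [I], and the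
    inclusion of [X] in [Y] is injective. So the top coefficient of [x] is a relation of [X] and can
    be subtracted. *)
Lemma filtered_exact_relations (x : 'rV[{poly A}]_gx) :
  factors (x *m Z) (pc AY) -> factors x (pc AX).
Proof.
have [e] := cf_bound x; elim: e x => [|J IHJ] x xe [w wE].
  by rewrite [x]cf_eq0 => [|j]; [exists 0; rewrite mul0mx | apply: xe].
have : factors (cf J x *m I) AY.
  exists (cf J.+1 w); rewrite -[RHS]cf_mul_pc -wE -[J.+1 in RHS]addn1 cf_mul_top //.
    by rewrite cfZ.
  by move=> [|[|j]] // _; rewrite cfZ.
case=> v vE; have [s sE] : factors (cf J x) AX.
  apply: exact_mx_factors exX _; apply: (@pc_Xmx_eq0 A _ c D).
  rewrite map_mxM -mulmxA -/WX -[LHS]scale1r -(rmorph1 polyC) -uq rmorphM -scalerA.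
  rewrite scalemxAr IE mulmxA -map_mxM vE map_mxM -mulmxA [pc AY *m _]mulmxA.
  by rewrite -map_mxM exY.1 map_mx0 mul0mx mulmx0 scaler0.
have xf : factors ('X^J *: pc (cf J x)) (pc AX).
  by apply: factorsZ; apply: factors_map; exists s.
rewrite -[x](subrK ('X^J *: pc (cf J x))); apply: factorsD => //.
apply: IHJ => [j|]; last first.
  rewrite mulmxBl -scaleN1r -scalemxAl; apply: factorsD; first by exists w.
  do 2!apply: factorsZ.
  by rewrite sE map_mxM -mulmxA; apply/factors_mull/filtered_relations_compat.
move=> le_Jj; rewrite cfB cf_scaleXn_pc; case: eqP => [->|/eqP neq_j]; first exact: subrr.
by rewrite subr0 xe // ltn_neqAle eq_sym neq_j.
Qed.

End FilteredRowSpace.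

(** Lowest stage of the mapping cone. Injectivity of [Z] modulo relations forces the first component
    of a kernel element into the row space of [AX]; correcting the second by the lift [f] leaves a
    relation of [AY]. *)
Lemma exact_mx_cone (A : comNzRingType) ax gx gy ay b (AX : 'M[A]_(ax, gx))
    (Z : 'M_(gx, gy)) (AY : 'M_(ay, gy)) (BY : 'M_(b, ay)) (f : 'M_(ax, ay)) u q :
  u * q = 1 ->
  (forall x : 'rV_gx, factors (x *m Z) AY -> factors x AX) ->
  q *: (AX *m Z) = f *m AY -> exact_mx BY AY ->
  exact_mx (block_mx (q *: AX) (- f) 0 BY) (col_mx Z AY).
Proof.
move=> uq ZAX fE [BA0 BA]; split.
  rewrite mul_block_col mul0mx add0r BA0 -scalemxAl fE mulNmx subrr.
  exact: col_mx0.
move=> x; rewrite -[x]hsubmxK; move: (lsubmx x) (rsubmx x) => {}x y.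
rewrite mul_row_col => xy0.
have [x' xE] : factors x AX.
  by apply: ZAX; exists (- y); rewrite mulNmx -[RHS]addr0 -xy0 addrCA addNr addr0.
have [y' yE] : factors (y + u *: (x' *m f)) BY.
  apply: BA; rewrite mulmxDl -scalemxAl -mulmxA -fE -scalemxAr scalerA uq scale1r.
  by rewrite mulmxA -xE addrC.
exists (row_mx (u *: x') y'); rewrite mul_row_block mulmx0 addr0; congr row_mx.
  by rewrite -scalemxAl -scalemxAr scalerA uq scale1r.
by rewrite -yE mulmxN -scalemxAl addrC addrK.
Qed.

(** * Polynomials in one variable over a family of rings *)

Section PolyFamily.
Variables (Lam : idomainType) (X : ringfam Lam).
Local Notation gen := (generic_pt Lam).
Local Notation "B @ p" := (map_mx (fam_ev X p) B) (at level 30).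
Local Notation "q %:X" := (fam_cst X q) (at level 2, format "q %:X").

Definition poly_ev (p : point Lam) : {rmorphism {poly X} -> {poly fam_fib X p}} :=
  map_poly (fam_ev X p).
Definition poly_cst : {rmorphism Lam -> {poly X}} := polyC \o fam_cst X.

Fact poly_unit p q : pt_map p q != 0 -> exists u, u * poly_ev p (poly_cst q) = 1.
Proof.
move=> /(fam_unit X)[u uq]; exists u%:P.
by rewrite /poly_ev /= map_polyC -polyCM uq.
Qed.

Fact poly_inj : injective (poly_ev gen).
Proof. exact: (map_inj_poly (@fam_inj _ X) (rmorph0 _)). Qed.

Fact poly_clear y : exists2 q, q != 0 &
  exists x, poly_ev gen x = poly_ev gen (poly_cst q) * y.
Proof.
have [q q0 [B BE]] := clear_mx (poly_rV y : 'rV_(size y)).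
exists q => //; exists (rVpoly B); rewrite /poly_ev /= map_polyC /= mul_polyC.
rewrite -{2}(poly_rV_K (leqnn (size y))) -linearZ -BE.
apply/polyP=> i; rewrite coef_map !coef_rVpoly /=.
by case: insub => [j|]; rewrite ?rmorph0 // mxE.
Qed.

Definition poly_family : ringfam Lam :=
  @RingFam Lam {poly X} (fun p => {poly fam_fib X p}) poly_ev poly_cst
    poly_unit poly_inj poly_clear.

Local Notation Y := poly_family.
Local Notation "B @@ p" := (map_mx (fam_ev Y p) B) (at level 30).

Lemma map_pc p r c (N : 'M[X]_(r, c)) : (pc N : 'M[Y]_(r, c)) @@ p = pc (N@p).
Proof. by apply/matrixP=> i j; rewrite !mxE /= /poly_ev /= map_polyC. Qed.

Lemma map_Xmx p c d : (Xmx X c d : 'M[Y]_(_, _)) @@ p = Xmx (fam_fib X p) c d.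
Proof.
apply/matrixP=> i j; rewrite !mxE /= /poly_ev.
by case: eqP => _; rewrite ?mulr1n ?mulr0n ?rmorph0 //= map_polyXn.
Qed.

Lemma map_scaleX p r c (W : 'M[Y]_(r, c)) : ('X *: W) @@ p = 'X *: (W @@ p).
Proof. by rewrite map_mxZ /= /poly_ev /= map_polyX. Qed.

Lemma map_cf p j r c (W : 'M[Y]_(r, c)) : (cf j W)@p = cf j (W @@ p).
Proof. by apply/matrixP=> i l; rewrite !mxE /= /poly_ev coef_map. Qed.

Lemma map_poly_cstZ p q r c (W : 'M[Y]_(r, c)) :
  (fam_cst Y q *: W) @@ p = (fam_ev X p q%:X)%:P *: (W @@ p).
Proof. by rewrite map_mxZ /= /poly_ev /= map_polyC. Qed.

Lemma const_clear r s c (U : 'M[Y]_(r, c)) (V : 'M[Y]_(s, c)) :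
  (forall i, exists z : 'rV_s, row i (U @@ gen) = pc z *m (V @@ gen)) ->
  exists2 q, q != 0 & exists C : 'M[X]_(r, s), fam_cst Y q *: U = pc C *m V.
Proof.
move=> /choice[z zE]; have [q q0 [C CE]] := clear_mx (\matrix_i z i).
exists q => //; exists C; apply: (@map_generic_inj _ Y).
rewrite map_poly_cstZ map_mxM map_pc CE map_mxZ -scalemxAl; congr (_ *: _).
by apply/row_matrixP=> i; rewrite zE row_mul -map_row rowK.
Qed.

Lemma resolved_pc d r c (N : 'M[X]_(r, c)) :
  resolved d N -> resolved d (pc N : 'M[Y]_(r, c)).
Proof.
elim: d r c N => [|d IHd] r c N /=; last first.
  case=> s [K [exK resK]]; exists s, (pc K); split; last exact: IHd.
  by apply: generically_imp exK => p; rewrite !map_pc; apply: pc_exact.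
apply: generically_imp => p Ninj x; rewrite map_pc.
have exN : exact_mx (0 : 'M_(0, r)) (N@p).
  split=> [|y /Ninj->]; first exact: flatmx0.
  by exists 0; rewrite mul0mx.
by case/(pc_exact exN).2=> y ->; rewrite [y]thinmx0 mul0mx.
Qed.

End PolyFamily.

Section PolyStep.
Variables (Lam : idomainType) (X : ringfam Lam).
Local Notation gen := (generic_pt Lam).
Local Notation Y := (poly_family X).
Local Notation A := (fam_fib X gen).

Lemma bounded_part_submodule (R : comNzRingType) c d (Q : 'rV[{poly R}]_c -> Prop) :
  submodule Q -> submodule (fun N : 'rV[R]_(\sum_(j < d) c) => Q (pc N *m Xmx R c d)).
Proof.
move=> subQ; split; first by rewrite map_mx0 mul0mx; case: subQ.
move=> a x y Qx Qy; rewrite map_mxD map_mxZ mulmxDl -scalemxAl.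
by apply: submoduleD => //; apply: submoduleZ.
Qed.

(* The leading coefficients of the elements of degree [d] of a submodule grow
   with [d]; from the degree [D] where they stop growing, the elements of
   degree [<= D] generate. *)
Lemma bounded_part_generates (R : comNzRingType) c (Q : 'rV[{poly R}]_c -> Prop) :
  noetherian R -> submodule Q -> exists D, forall s (W : 'M[{poly R}]_(s, c)),
    (forall v, Q v -> (forall j, (D < j)%N -> cf j v = 0) -> factors v W) ->
  forall v, Q v -> factors v W.
Proof.
move=> noethR subQ; pose L d (v : 'rV[R]_c) := exists u : 'rV_c,
  [/\ Q u, forall j, (d < j)%N -> cf j u = 0 & cf d u = v].
have LS d e v : (d <= e)%N -> L d v -> L e v.
  move=> /subnK <-; elim: (e - d)%N => // n IHn /IHn[u [Qu ud <-]].
  exists ('X^1 *: u); split; first exact: submoduleZ.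
    by move=> [|j] // lt_j; rewrite cf_scaleXn subn1 ud.
  by rewrite cf_scaleXn subn1.
(* The module of all leading coefficients is finitely generated; [D] is the largest of the degrees
   in which its generators are found. *)
have [|s [W WE]] := noethR c (fun v => exists d, L d v).
  split.
    exists 0%N, 0; split; first by case: subQ.
      by move=> j _; rewrite raddf0.
    by rewrite raddf0.
  move=> a x y [d xd] [e ye]; exists (maxn d e).
  have [u [Qu ud <-]] := LS _ _ _ (leq_maxl d e) xd.
  have [v [Qv vd <-]] := LS _ _ _ (leq_maxr d e) ye.
  have cfE j : cf j (a%:P *: u + v) = a *: cf j u + cf j v.
    by apply/matrixP=> i l; rewrite !mxE /= coefD coefCM.
  exists (a%:P *: u + v); split; rewrite ?cfE //.
    by apply: submoduleD => //; apply: submoduleZ.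
  by move=> j lt_j; rewrite cfE ud // vd // scaler0 addr0.
have /choice[dW dWP] : forall i, exists d, L d (row i W).
  by move=> i; apply/WE; exists (delta_mx 0 i); rewrite rowE.
pose D := \max_i dW i; exists D => t V VP.
have stab d v : L d v -> L D v.
  move=> Ld; have [y ->] : factors v W by apply/WE; exists d.
  have /choice[f fP] : forall i, L D (row i W).
    by move=> i; apply: LS (leq_bigmax i) (dWP i).
  exists (pc y *m \matrix_i f i); split.
  - apply: submodule_mulmx => // i; rewrite rowK.
    by have [] := fP i.
  - move=> j lt_j; rewrite cf_pc_mul.
    have -> : cf j (\matrix_i f i) = 0; last exact: mulmx0.
    apply/row_matrixP=> i; rewrite -map_row rowK row0.
    by have [_ fD _] := fP i; apply: fD.
  rewrite cf_pc_mul; congr (_ *m _); apply/row_matrixP=> i.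
  by rewrite -map_row rowK; have [] := fP i.
suff h e v : Q v -> (forall j, (e <= j)%N -> cf j v = 0) -> factors v V.
  by move=> v Qv; have [e] := cf_bound v; apply: h.
elim: e v => [|e IHe] v Qv ve.
  by rewrite [v]cf_eq0 => [|j]; [exists 0; rewrite mul0mx | apply: ve].
have [le_eD|lt_De] := leqP e D.
  by apply: VP => // j lt_j; apply: ve; apply: leq_ltn_trans lt_j.
have [u [Qu uD ue]] : L D (cf e v) by apply: (stab e); exists v.
(* Subtracting a shifted element of degree [<= D] cancels the coefficient of degree [e]. *)
rewrite -[v](subrK ('X^(e - D) *: u)); apply: factorsD; last first.
  by apply: factorsZ; apply: VP.
apply: IHe => [|j le_ej].
  by rewrite -scaleN1r; apply: submoduleD => //; do 2!apply: submoduleZ => //.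
rewrite cfB cf_scaleXn ltnNge (leq_trans (leq_subr _ _) le_ej) /=.
move: le_ej; rewrite leq_eqVlt => /orP[/eqP<-|lt_ej].
  by rewrite (subKn (ltnW lt_De)) ue subrr.
rewrite ve // uD ?subr0 //.
by rewrite -{1}(subKn (ltnW lt_De)) ltn_sub2r // (leq_ltn_trans (leq_subr _ _)).
Qed.

(** Hilbert's basis theorem: the part of degree [<= D] generates [Q], and it is a submodule of a
    free module of finite rank over [R]. *)
Lemma poly_noetherian (R : comNzRingType) : noetherian R -> noetherian {poly R}.
Proof.
move=> noethR c Q subQ; have [D DP] := bounded_part_generates noethR subQ.
have [s [W WE]] := noethR _ _ (bounded_part_submodule D.+1 subQ).
exists s, (pc W *m Xmx R c D.+1) => v; split=> [|[y ->]].
  apply: DP => {}v Qv /pc_Xmx_surj[y yE]; rewrite yE in Qv.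
  by rewrite yE; apply/factors_mulr/factors_map/WE.
apply: submodule_mulmx => // i; rewrite row_mul -map_row.
by apply/WE; exists (delta_mx 0 i); rewrite rowE.
Qed.

Lemma poly_syzygetic : syzygetic X -> syzygetic Y.
Proof.
move=> synX; have [noethA syz] := synX; split; first exact: poly_noetherian.
move=> r c B.
pose B0 : 'M[{poly A}]_(r, c) := map_mx (fam_ev Y gen) B.
have [D DP] := bounded_part_generates noethA (factors_submodule B0).
(* Generators of the part of degree [< d] are found over the generic fibre, cleared of denominators,
   and exchanged for generators with a finite resolution over the base family. *)
have bounded_part d : exists g (N : 'M[X]_(g, \sum_(j < d) c)) e, resolved e N /\
    forall v : 'rV_(\sum_(j < d) c), factors (pc v *m Xmx A c d) B0 <->
      factors v (map_mx (fam_ev X gen) N).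
  have [s [W WE]] := noethA _ _ (bounded_part_submodule d (factors_submodule B0)).
  have [q q0 [N NE]] := clear_mx W.
  have [w [N' [e [NN' resN']]]] := syz _ _ N.
  exists w, N', e; split=> // v.
  have [NN'g N'Ng] := generically_generic NN'.
  have [|u uq] := @fam_unit _ X gen q; first by rewrite tofrac_eq0.
  split=> [/WE vW|vN'].
    apply: factors_trans NN'g; apply: factors_trans vW _.
    by apply: factors_unit uq _; rewrite -NE; apply: factors_refl.
  apply/WE; apply: factors_trans (factors_trans vN' N'Ng) _.
  by rewrite NE; apply: factorsZ; apply: factors_refl.
have [gx [NX [ex [resX QX]]]] := bounded_part D.
have [gy [NY [ey [resY QY]]]] := bounded_part D.+1.
pose WX : 'M[Y]_(gx, c) := pc NX *m Xmx X c D.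
pose WY : 'M[Y]_(gy, c) := pc NY *m Xmx X c D.+1.
have WXp p : map_mx (fam_ev Y p) WX = pc (map_mx (fam_ev X p) NX) *m Xmx _ c D.
  by rewrite map_mxM map_pc map_Xmx.
have WYp p : map_mx (fam_ev Y p) WY = pc (map_mx (fam_ev X p) NY) *m Xmx _ c D.+1.
  by rewrite map_mxM map_pc map_Xmx.
have inX (v : 'rV_c) : factors v B0 -> (forall j, (D <= j)%N -> cf j v = 0) ->
    exists z, v = pc z *m map_mx (fam_ev Y gen) WX.
  move=> vB /pc_Xmx_surj[y yE]; rewrite yE in vB.
  have [z zE] := (QX y).1 vB; exists z.
  by rewrite yE zE map_mxM -mulmxA WXp.
have inY (v : 'rV_c) : factors v B0 -> (forall j, (D < j)%N -> cf j v = 0) ->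
    exists z, v = pc z *m map_mx (fam_ev Y gen) WY.
  move=> vB /pc_Xmx_surj[y yE]; rewrite yE in vB.
  have [z zE] := (QY y).1 vB; exists z.
  by rewrite yE zE map_mxM -mulmxA WYp.
have WXB : factors (map_mx (fam_ev Y gen) WX) B0.
  apply: factors_row => i; rewrite WXp row_mul -map_row.
  by apply/QX; exists (delta_mx 0 i); rewrite rowE.
have WYB : factors (map_mx (fam_ev Y gen) WY) B0.
  apply: factors_row => i; rewrite WYp row_mul -map_row.
  by apply/QY; exists (delta_mx 0 i); rewrite rowE.
have rowB s (W : 'M_(s, c)) i : factors W B0 -> factors (row i W) B0.
  by rewrite rowE; apply: factors_mull.
have degX i j : (D <= j)%N -> cf j (row i (map_mx (fam_ev Y gen) WX)) = 0.
  by move=> le_Dj; rewrite map_row WXp pc_Xmx_deg // row0.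
have degY i j : (D < j)%N -> cf j (row i (map_mx (fam_ev Y gen) WY)) = 0.
  by move=> le_Dj; rewrite map_row WYp pc_Xmx_deg // row0.
(* The three matrices exist for reasons of degree: the rows of [WX] and of ['X *: WX] have degree
   [<= D], so they lie in [Y]; the rows of [K] cancel the terms of degree [D], so those of
   [pc K *m WY] lie in [X]. *)
have [q1 q1_0 [I IE]] : exists2 q, q != 0 &
    exists C : 'M[X]_(gx, gy), fam_cst Y q *: WX = pc C *m WY.
  apply: const_clear => i; apply: inY => [|j lt_Dj]; first exact: rowB.
  exact: degX (ltnW lt_Dj).
have [q2 q2_0 [T TE]] : exists2 q, q != 0 &
    exists C : 'M[X]_(gx, gy), fam_cst Y q *: ('X *: WX : 'M[Y]_(gx, c)) = pc C *m WY.
  apply: const_clear => i; apply: inY => [|[|j] lt_Dj] //.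
    by apply: rowB; rewrite map_scaleX; apply: factorsZ.
  by rewrite map_scaleX linearZ -['X]expr1 cf_scaleXn subn1; apply: degX.
have [k [K exK]] := syzygetic_ker synX (cf D WY : 'M[X]_(gy, c)).
have [q3 q3_0 [U UE]] : exists2 q, q != 0 &
    exists C : 'M[X]_(k, gx), fam_cst Y q *: (pc K *m WY) = pc C *m WX.
  have [KW _] := generically_generic exK; rewrite map_cf in KW.
  have KWE : map_mx (fam_ev Y gen) (pc K *m WY) =
      pc (map_mx (fam_ev X gen) K) *m map_mx (fam_ev Y gen) WY.
    by rewrite map_mxM map_pc.
  apply: const_clear => i; apply: inX => [|j].
    by apply: rowB; rewrite KWE; apply: factors_mull.
  rewrite KWE map_row cf_pc_mul leq_eqVlt => /orP[/eqP<-|lt_Dj].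
    by rewrite KW row0.
  by rewrite WYp pc_Xmx_deg // mulmx0 row0.
(* The two extra steps are the relations [col_mx Z (pc AY)] of [WY] and the block matrix that starts
   the mapping cone. *)
exists gy, WY, (maxn ex ey).+2; split.
  apply: generically_and; apply: factors_generically => //.
  apply: factors_row => i; apply: DP => [v vB /(inY v vB)[z ->]|]; first by exists (pc z).
  exact/rowB/factors_refl.
have [ax [AX [exX resAX]]] := resolvedS resX.
have [ay [AY [exY [b [BY [exBY resBY]]]]]] := resolvedS (resolvedS resY).
(* Inclusion and multiplication by [t] must carry the same scalar for [Z] to kill [WY]. *)
pose q := q1 * q2; pose I' := (fam_cst X q2) *: I; pose T' := (fam_cst X q1) *: T.
have q_0 : q != 0 by apply: mulf_neq0.
pose Z : 'M[Y]_(gx, gy) := 'X *: pc I' - pc T'.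
have Zp p : map_mx (fam_ev Y p) Z =
    'X *: pc (map_mx (fam_ev X p) I') - pc (map_mx (fam_ev X p) T').
  by rewrite map_mxB map_scaleX !map_pc.
have : generically (fun p =>
    [/\ exact_mx (map_mx (fam_ev Y p) (col_mx Z (pc AY))) (map_mx (fam_ev Y p) WY),
        factors (map_mx (fam_ev Y p) (pc AX *m Z)) (map_mx (fam_ev Y p) (pc AY)) &
        forall x : 'rV_gx, factors (x *m map_mx (fam_ev Y p) Z) (map_mx (fam_ev Y p) (pc AY)) ->
          factors x (map_mx (fam_ev Y p) (pc AX))]).
  have := generically_and (generically_neq0 q_0) (generically_and (generically_neq0 q3_0)
    (generically_and exK (generically_and exX exY))).
  apply: generically_imp => p [pq [pq3 [exKp [exXp exYp]]]].
  have [u uq] := fam_unit X pq; have [u3 uq3] := fam_unit X pq3.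
  have IEp : (fam_ev X p (fam_cst X q))%:P *: (pc (map_mx (fam_ev X p) NX) *m Xmx _ c D) =
      pc (map_mx (fam_ev X p) I') *m (pc (map_mx (fam_ev X p) NY) *m Xmx _ c D.+1).
    rewrite -WXp -WYp -map_pc -map_mxM -map_poly_cstZ; congr map_mx.
    by rewrite /q mulrC rmorphM -scalerA IE /I' map_mxZ scalemxAl.
  have TEp : (fam_ev X p (fam_cst X q))%:P *: ('X *: (pc (map_mx (fam_ev X p) NX) *m Xmx _ c D)) =
      pc (map_mx (fam_ev X p) T') *m (pc (map_mx (fam_ev X p) NY) *m Xmx _ c D.+1).
    rewrite -WXp -WYp -map_pc -map_mxM -map_scaleX -map_poly_cstZ; congr map_mx.
    by rewrite /q rmorphM -scalerA TE /T' map_mxZ scalemxAl.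
  have {}exKp : exact_mx (map_mx (fam_ev X p) K)
      (cf D (pc (map_mx (fam_ev X p) NY) *m Xmx (fam_fib X p) c D.+1)).
    by rewrite -WYp -map_cf.
  have UEp : exists U',
      pc (map_mx (fam_ev X p) K) *m (pc (map_mx (fam_ev X p) NY) *m Xmx _ c D.+1) =
      pc U' *m (pc (map_mx (fam_ev X p) NX) *m Xmx _ c D).
    exists (u3 *: map_mx (fam_ev X p) U); rewrite -WXp -WYp map_mxZ -scalemxAl.
    rewrite -!map_pc -!map_mxM -UE map_poly_cstZ scalerA -rmorphM uq3 scale1r //.
  rewrite WYp map_col_mx map_mxM Zp !map_pc; split.
  - exact: filtered_exact_generators uq IEp TEp exKp UEp exYp.
  - exact: filtered_relations_compat IEp TEp exXp exYp.
  exact: filtered_exact_relations uq IEp TEp exXp exYp.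
move=> genZ; exists (gx + ay)%N, (col_mx Z (pc AY)); split.
  by apply: generically_imp genZ => p [].
(* Up to [q4], the matrix [f] lifts the first map of the exact sequence to the relations. *)
have [_ /factors_clear[q4 q4_0 [f fE]] _] := generically_generic genZ.
exists (ax + b)%N, (block_mx (fam_cst Y q4 *: (pc AX : 'M[Y]_(_, _))) (- f) 0 (pc BY)); split.
  have := generically_and (generically_neq0 q4_0) (generically_and genZ exBY).
  apply: generically_imp => p [pq4 [[_ _ ZAX] exBYp]].
  have [u uq] := fam_unit Y pq4.
  rewrite map_block_mx map_col_mx map_mx0 map_mxN map_mxZ.
  apply: exact_mx_cone uq ZAX _ _; last by rewrite !map_pc; apply: pc_exact.
  by rewrite -!map_mxM -fE map_mxZ.
apply: resolved_cone.
- apply: resolved_scale => //; apply: resolved_pc.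
  exact: resolved_leq (leq_maxl _ _) resAX.
- by apply: resolved_pc; apply: resolved_leq (leq_maxr _ _) resBY.
have := generically_and (generically_neq0 q4_0) (generically_and exX exBY).
apply: generically_imp => p [pq4 [exXp /(@pc_exact _ _ _ _ _ _)exBYp]] x.
have [u uq] := fam_unit Y pq4.
rewrite map_mxZ -scalemxAr => xAX; rewrite [map_mx _ (pc BY)]map_pc; apply: exBYp.2.
rewrite -map_pc map_mxN mulmxN mulNmx -mulmxA -map_mxM -fE map_mxZ map_mxM.
by rewrite -scalemxAr mulmxA scalemxAl xAX mul0mx oppr0.
Qed.

End PolyStep.

(** * Transport along isomorphisms of rings and of families *)

Section Transfer.
Variables (A B : comNzRingType) (h : {rmorphism A -> B}).
Hypothesis h_bij : bijective h.
Local Notation "M ^h" := (map_mx h M) (at level 8, format "M ^h").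

Lemma map_mx_bij_surj r c (M : 'M[B]_(r, c)) : exists N, N^h = M.
Proof.
have [g _ gK] := h_bij; exists (map_mx g M).
by apply/matrixP=> i j; rewrite !mxE gK.
Qed.

Lemma map_mx_bij_inj r c : injective (fun M : 'M[A]_(r, c) => M^h).
Proof.
move=> M N /matrixP MN; apply/matrixP=> i j; apply: (bij_inj h_bij).
by have := MN i j; rewrite !mxE.
Qed.

Lemma factors_map_bij r w c (M : 'M[A]_(r, c)) (W : 'M_(w, c)) :
  factors M^h W^h <-> factors M W.
Proof.
split=> [[C ME]|]; last exact: factors_map.
have [D DE] := map_mx_bij_surj C; exists D; apply: map_mx_bij_inj.
by rewrite map_mxM DE.
Qed.

Lemma exact_mx_map_bij s r c (N : 'M[A]_(s, r)) (M : 'M[A]_(r, c)) :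
  exact_mx N^h M^h <-> exact_mx N M.
Proof.
have eq0 t e (V : 'M[A]_(t, e)) : V^h = 0 <-> V = 0.
  by split=> [V0|->]; [apply: map_mx_bij_inj; rewrite V0 map_mx0 | rewrite map_mx0].
rewrite /exact_mx -map_mxM; split=> [[/eq0 NM0 NM]|[NM0 NM]].
  by split=> // x xM; apply/factors_map_bij/NM; rewrite -map_mxM xM map_mx0.
split=> [|x]; first exact/eq0.
by have [y <-] := map_mx_bij_surj x; rewrite -map_mxM => /eq0/NM/factors_map_bij.
Qed.

Lemma noetherian_map_bij : noetherian B -> noetherian A.
Proof.
move=> noethB c Q [Q0 Qlin].
have [|s [W WE]] := noethB c (fun v => exists2 u, u^h = v & Q u).
  split=> [|a x y [u <- Qu] [v <- Qv]]; first by exists 0; rewrite ?map_mx0.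
  have [g _ gK] := h_bij; exists (g a *: u + v); last exact: Qlin.
  by rewrite map_mxD map_mxZ gK.
have [V VE] := map_mx_bij_surj W; exists s, V => v.
rewrite -factors_map_bij VE -WE; split=> [Qv|[u /map_mx_bij_inj->]] //.
by exists v.
Qed.

End Transfer.

Section FamilyTransfer.
Variables (Lam : idomainType) (Y X : ringfam Lam).
Variables (g : {rmorphism Y -> X}) (h : forall p, {rmorphism fam_fib Y p -> fam_fib X p}).
Hypotheses (g_bij : bijective g) (h_bij : forall p, bijective (h p)).
Hypothesis hg : forall p y, h p (fam_ev Y p y) = fam_ev X p (g y).

Fact map_hg p r c (M : 'M[Y]_(r, c)) :
  map_mx (fam_ev X p) (map_mx g M) = map_mx (h p) (map_mx (fam_ev Y p) M).
Proof. by apply/matrixP=> i j; rewrite !mxE hg. Qed.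

Lemma resolved_transfer d r c (M : 'M[Y]_(r, c)) :
  resolved d (map_mx g M) -> resolved d M.
Proof.
elim: d r c M => [|d IHd] r c M /=.
  apply: generically_imp => p Minj x xM; apply: (map_mx_bij_inj (h_bij p)).
  by rewrite map_mx0; apply: Minj; rewrite map_hg -map_mxM xM map_mx0.
case=> s [N []]; have [N' <-] := map_mx_bij_surj g_bij N => exN /IHd resN'.
exists s, N'; split=> //; apply: generically_imp exN => p.
by rewrite !map_hg => /(exact_mx_map_bij (h_bij p)).
Qed.

Lemma syzygetic_transfer : syzygetic X -> syzygetic Y.
Proof.
move=> [noethX syz]; split; first exact: noetherian_map_bij (h_bij _) noethX.
move=> r c B; have [w [W [d]]] := syz _ _ (map_mx g B).
have [W' <-] := map_mx_bij_surj g_bij W => -[BW resW].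
exists w, W', d; split; last exact: resolved_transfer.
by apply: generically_imp BW => p; rewrite !map_hg => -[]; split; apply/(factors_map_bij (h_bij p)).
Qed.

End FamilyTransfer.

Lemma map_mpoly_inj (A B : comNzRingType) (f : {rmorphism A -> B}) n :
  injective f -> injective (@map_mpoly n A B f).
Proof.
move=> f_inj x y /mpolyP xy; apply/mpolyP=> m; apply: f_inj.
by have := xy m; rewrite !mcoeff_map_mpoly.
Qed.

(** * Multivariate polynomials *)

Section MpolyFamily.
Variables (Lam : idomainType) (n : nat).
Local Notation gen := (generic_pt Lam).

Definition mpoly_ev (p : point Lam) : {rmorphism {mpoly Lam[n]} -> {mpoly (pt_field p)[n]}} :=
  map_mpoly (pt_map p).
Definition mpoly_cst : {rmorphism Lam -> {mpoly Lam[n]}} := @mpolyC n Lam.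

Fact mpoly_unit p q : pt_map p q != 0 -> exists u, u * mpoly_ev p (mpoly_cst q) = 1.
Proof.
move=> q0; exists (pt_map p q)^-1%:MP.
by rewrite /mpoly_ev /= map_mpolyC -mpolyCM mulVf.
Qed.

Fact mpoly_inj : injective (mpoly_ev gen).
Proof.
exact: map_mpoly_inj (@base_inj Lam).
Qed.

Fact mpoly_clear y : exists2 q, q != 0 &
  exists x, mpoly_ev gen x = mpoly_ev gen (mpoly_cst q) * y.
Proof.
have [q q0 [B BE]] := @clear_mx _ (base_family Lam) _ _
  (\row_(i < size (msupp y)) y@_(tnth (in_tuple (msupp y)) i)).
exists q => //; exists (\sum_i B 0 i *: 'X_[tnth (in_tuple (msupp y)) i]).
rewrite /mpoly_ev /= map_mpolyC mul_mpolyC [in RHS](mpolyE y) raddf_sum /=.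
rewrite (big_tnth _ _ (msupp y)) scaler_sumr; apply: eq_bigr => i _.
rewrite map_mpolyZ map_mpolyX scalerA; congr (_ *: _).
by have /rowP/(_ i) := BE; rewrite !mxE.
Qed.

Definition mpoly_family : ringfam Lam :=
  @RingFam Lam {mpoly Lam[n]} (fun p => {mpoly (pt_field p)[n]}) mpoly_ev mpoly_cst
    mpoly_unit mpoly_inj mpoly_clear.

End MpolyFamily.

(** * Separating the last variable *)

Section Muni.
Variable n : nat.
Implicit Types A B : comNzRingType.

Definition mcons (m : 'X_{1..n}) i : 'X_{1..n.+1} := [multinom of rcons m i].

Lemma mcons_widen m i (j : 'I_n) : mcons m i (widen_ord (leqnSn n) j) = m j.
Proof.
by rewrite /mcons multinomE (tnth_nth 0%N) /= nth_rcons size_tuple ltn_ord -tnth_nth.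
Qed.

Lemma mcons_max m i : mcons m i ord_max = i.
Proof. by rewrite /mcons multinomE (tnth_nth 0%N) /= nth_rcons size_tuple ltnn eqxx. Qed.

Lemma mcons_eq (m : 'X_{1..n}) i (m' : 'X_{1..n.+1}) :
  (m' == mcons m i) =
  ([multinom m' (widen_ord (leqnSn n) j) | j < n] == m)%MM && (m' ord_max == i).
Proof.
apply/eqP/andP=> [->|[/eqP <- /eqP <-]].
  by split; [apply/eqP/mnmP=> j; rewrite mnmE mcons_widen | rewrite mcons_max].
apply/mnmP=> j; case: (unliftP ord_max j) => [j'|] ->; last by rewrite mcons_max.
have -> : lift ord_max j' = widen_ord (leqnSn n) j'.
  by apply: val_inj; rewrite /= /bump leqNgt ltn_ord.
by rewrite mcons_widen mnmE.
Qed.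

Lemma muni_coef A (p : {mpoly A[n.+1]}) i m : (muni p)`_i@_m = p@_(mcons m i).
Proof.
rewrite [in RHS](mpolyE p) muniE coef_sum !raddf_sum /=; apply: eq_bigr => m' _.
rewrite coefZ coefXn mcoeffZ mcoeffX mcons_eq eq_sym.
case: eqP => _; last by rewrite mulr0 mcoeff0 andbF mulr0.
by rewrite mulr1 andbT mcoeffZ mcoeffX.
Qed.

Lemma muni_bij A : bijective (@muni n A).
Proof.
have muni_surj q : exists p, @muni n A p = q.
  rewrite -[q]coefK poly_def; elim/big_ind: _ => [|_ _ [x <-] [y <-]|i _].
  - by exists 0; rewrite muni0.
  - by exists (x + y); rewrite muniD.
  rewrite (mpolyE q`_i) scaler_suml; elim/big_ind: _ => [|_ _ [x <-] [y <-]|m _].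
  - by exists 0; rewrite muni0.
  - by exists (x + y); rewrite muniD.
  exists (q`_i@_m *: 'X_[mcons m i]); rewrite muniZ muniE msuppX big_seq1 mcoeffX eqxx.
  rewrite mcons_max scale1r scalerA mul_mpolyC; congr (_ *: 'X_[_] *: _).
  by apply/mnmP=> j; rewrite mnmE mcons_widen.
have /choice[g gK] := muni_surj; exists g => // p.
apply/mpolyP=> m; pose m' := [multinom m (widen_ord (leqnSn n) j) | j < n]%MM.
have -> : m = mcons m' (m ord_max) by apply/eqP; rewrite mcons_eq !eqxx.
by rewrite -!muni_coef gK.
Qed.

Lemma muni_map A B (f : {rmorphism A -> B}) (p : {mpoly A[n.+1]}) :
  muni (map_mpoly f p) = map_poly (map_mpoly f) (muni p).
Proof.
apply/polyP=> i; apply/mpolyP=> m.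
by rewrite coef_map /= muni_coef !mcoeff_map_mpoly muni_coef.
Qed.

End Muni.

(** A form of Hilbert's syzygy theorem that is uniform over almost all points. Polynomials in no
    variables are constants, and [muni] views [n.+1] variables as one variable over [n] others. *)
Lemma mpoly_syzygetic (Lam : idomainType) n : syzygetic (mpoly_family Lam n).
Proof.
elim: n => [|n IHn].
  have coef_bij (A : comNzRingType) : bijective (@mcoeff 0 A 0%MM).
    exists (@mpolyC 0 A); last exact: mpolyCK.
    move=> p; apply/mpolyP=> m; rewrite mcoeffC.
    by rewrite (_ : m = 0%MM) ?eqxx ?mulr1 //; apply/mnmP=> -[].
  apply: (@syzygetic_transfer _ (mpoly_family Lam 0) (base_family Lam)
    (@mcoeff 0 Lam 0%MM) (fun p => @mcoeff 0 (pt_field p) 0%MM)).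
  - exact: coef_bij.
  - by move=> p; apply: coef_bij.
  - by move=> p y; rewrite /= /mpoly_ev /= mcoeff_map_mpoly.
  exact: base_syzygetic.
apply: (@syzygetic_transfer _ (mpoly_family Lam n.+1) (poly_family (mpoly_family Lam n))
    (@muni n Lam) (fun p => @muni n (pt_field p))).
- exact: muni_bij.
- by move=> p; apply: muni_bij.
- by move=> p y; apply: muni_map.
exact: poly_syzygetic.
Qed.

(** * Comparison of projective resolutions *)

Section SubmoduleType.
Variables (A : comNzRingType) (U : lmodType A) (Q : U -> Prop) (subQ : submodule Q).

(** The closure proof is an argument of the predicate, so that structure inference can recover
    it. *)
Definition subm_pred of submodule Q : {pred U} := fun x => `[< Q x >].

Fact subm_closed : submod_closed (subm_pred subQ).
Proof.
case: subQ => Q0 Qlin; split=> [|a x y /asboolP Qx /asboolP Qy]; apply/asboolP => //.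
exact: Qlin.
Qed.

HB.instance Definition _ :=
  GRing.isSubmodClosed.Build A U (subm_pred subQ) subm_closed.

Record subm : predArgType :=
  Subm { subm_val : U; subm_valP : subm_val \in subm_pred subQ }.

HB.instance Definition _ := [isSub for subm_val].
HB.instance Definition _ := [Choice of subm by <:].
HB.instance Definition _ := [SubChoice_isSubLmodule of subm by <:].

Lemma subm_valQ (x : subm) : Q (val x).
Proof. exact/asboolP/subm_valP. Qed.

Lemma subm_surj x : Q x -> exists y : subm, val y = x.
Proof. by move=> /asboolP Qx; exists (Subm (Qx : x \in subm_pred subQ)). Qed.

End SubmoduleType.

Section LinearMaps.
Variable A : comNzRingType.

(** A total linear relation whose only value at zero is zero is the graph of a linear map. Maps
    defined by chosen preimages are obtained this way, although the choice itself is not linear. *)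
Lemma linear_of_rel (U V : lmodType A) (R : U -> V -> Prop) :
  (forall u, exists v, R u v) ->
  (forall a u u' v v', R u v -> R u' v' -> R (a *: u + u') (a *: v + v')) ->
  (forall v, R 0 v -> v = 0) ->
  exists f : {linear U -> V}, forall u v, R u v <-> v = f u.
Proof.
move=> /choice[f fR] Rlin R0.
have Rfun u v v' : R u v -> R u v' -> v = v'.
  move=> Rv Rv'; apply/esym/eqP; rewrite -subr_eq0 -scaleN1r addrC; apply/eqP/R0.
  by rewrite -[0](addNr u) -scaleN1r; apply: Rlin.
have f_lin : linear f.
  by move=> a u u'; apply: Rfun (fR _) _; apply: Rlin.
pose F : {linear U -> V} := HB.pack f (GRing.isLinear.Build A U V *:%R f f_lin).
by exists F => u v; split=> [/Rfun|->]; [apply; apply: fR | apply: fR].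
Qed.

(** Projectivity is stated for surjections, so [g] and [f] are corestricted to the image of [g]. *)
Lemma projective_lift (P X Y : lmodType A) (g : {linear X -> Y}) (f : {linear P -> Y}) :
  projective P -> (forall p, exists x, g x = f p) ->
  exists h : {linear P -> X}, forall p, g (h p) = f p.
Proof.
move=> projP fg; pose Q y := exists x, g x = y.
have subQ : submodule Q.
  split=> [|a _ _ [x <-] [y <-]]; first by exists 0; rewrite linear0.
  by exists (a *: x + y); rewrite linearP.
have lift (W : lmodType A) (l : {linear W -> Y}) : (forall w, Q (l w)) ->
    exists l' : {linear W -> subm subQ}, forall w, val (l' w) = l w.
  move=> Ql; have [|a u u' v v' lu lu'|v v0|l' l'E] :=
    @linear_of_rel W (subm subQ) (fun w y => l w = val y).
  - by move=> w; have [y] := subm_surj subQ (Ql w); exists y.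
  - by rewrite linearP lu lu' [RHS]linearP.
  - by apply: val_inj; rewrite -v0 !linear0.
  by exists l' => w; apply/esym/l'E.
have [g' g'E] := lift _ g (fun x => ex_intro _ x erefl).
have [f' f'E] := lift _ f fg.
have [y|h hE] := projP _ _ g' f'.
  by have [x xE] := subm_valQ y; exists x; apply: val_inj; rewrite g'E.
by exists h => p; rewrite -g'E hE f'E.
Qed.

Lemma row_projective n : projective 'rV[A]_n.
Proof.
move=> X Y g f g_surj; have [s sK] := choice g_surj.
pose h (v : 'rV[A]_n) := \sum_i v 0 i *: s (f (delta_mx 0 i)).
have h_lin : linear h.
  move=> a u v; rewrite /h scaler_sumr -big_split; apply: eq_bigr => i _.
  by rewrite !mxE scalerDl scalerA.
pose H : {linear 'rV[A]_n -> X} := HB.pack h (GRing.isLinear.Build A _ _ *:%R h h_lin).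
exists H => v; rewrite /= /h linear_sum [in RHS](row_sum_delta v) linear_sum.
by apply: eq_bigr => i _; rewrite !linearZ /= sK.
Qed.

End LinearMaps.

(** Builds chain maps and homotopies degree by degree; the invariant [good] records that the next
    lift exists. *)
Lemma dependent_choice (T : nat -> Type) (good : forall j, T j -> Prop)
    (R : forall j, T j -> T j.+1 -> Prop) (x0 : T 0%N) :
  good 0%N x0 -> (forall j x, good j x -> exists y, R j x y /\ good j.+1 y) ->
  exists f : forall j, T j, f 0%N = x0 /\ forall j, R j (f j) (f j.+1).
Proof.
move=> good0 next.
have step j (x : {x : T j | good j x}) : {y : {y : T j.+1 | good j.+1 y} | R j (sval x) (sval y)}.
  by have /cid[y [Rxy gy]] := next _ _ (svalP x); exists (exist _ y gy).
pose f := fix f j : {x : T j | good j x} :=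
  if j is j'.+1 then sval (step j' (f j')) else exist _ x0 good0.
by exists (fun j => sval (f j)); split=> // j; apply: svalP (step j (f j)).
Qed.

Section Comparison.
Variables (A : comNzRingType) (L : lmodType A).
Implicit Types P : projective_resolution L.

Lemma res_dd P j x : res_d P j (res_d P j.+1 x) = 0.
Proof. by apply/res_exact; exists x. Qed.

Lemma res_augd P x : res_aug P (res_d P 0 x) = 0.
Proof. by apply/res_exact0; exists x. Qed.

Lemma comparison P P' : exists f : forall j, {linear P j -> P' j},
  (forall x, res_aug P' (f 0%N x) = res_aug P x) /\
  forall j x, res_d P' j (f j.+1 x) = f j (res_d P j x).
Proof.
have [f0 f0E] : exists f0 : {linear P 0%N -> P' 0%N}, forall x, res_aug P' (f0 x) = res_aug P x.
  by apply: projective_lift => [|x]; [apply: res_projective | apply: res_aug_surj].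
have [|j f good_f|f [f0' fE]] := @dependent_choice (fun j => {linear P j -> P' j})
  (fun j f => forall x, exists y, res_d P' j y = f (res_d P j x))
  (fun j f f' => forall x, res_d P' j (f' x) = f (res_d P j x)) f0.
- by move=> x; apply/res_exact0; rewrite f0E res_augd.
- have [f' f'E] := projective_lift (f := f \o res_d P j) (@res_projective _ _ P j.+1) good_f.
  by exists f'; split=> // x; apply/res_exact; rewrite f'E /= res_dd linear0.
by exists f; rewrite f0'; split.
Qed.

(** A chain map over the zero map is null-homotopic: in each degree [u - s d] takes values in
    cycles, hence in boundaries, and lifts by projectivity. *)
Lemma homotopy P P' (u : forall j, {linear P j -> P' j}) :
  (forall x, res_aug P' (u 0%N x) = 0) ->
  (forall j x, res_d P' j (u j.+1 x) = u j (res_d P j x)) ->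
  exists s : forall j, {linear P j -> P' j.+1},
    (forall x, u 0%N x = res_d P' 0 (s 0%N x)) /\
    forall j x, u j.+1 x = res_d P' j.+1 (s j.+1 x) + s j (res_d P j x).
Proof.
move=> u0 uE.
have [s0 s0E] : exists s0 : {linear P 0%N -> P' 1%N}, forall x, res_d P' 0 (s0 x) = u 0%N x.
  apply: projective_lift => [|x]; first exact: res_projective.
  exact/res_exact0.
have [|j s good_s|s [s0' sE]] := @dependent_choice (fun j => {linear P j -> P' j.+1})
  (fun j s => forall x, exists y, res_d P' j.+1 y = u j.+1 x - s (res_d P j x))
  (fun j s s' => forall x, u j.+1 x = res_d P' j.+1 (s' x) + s (res_d P j x)) s0.
- by move=> x; apply/res_exact; rewrite linearB uE s0E subrr.
- have [s' s'E] := 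
    projective_lift (f := u j.+1 \- (s \o res_d P j)) (@res_projective _ _ P j.+1) good_s.
  have {}s'E x : u j.+1 x = res_d P' j.+1 (s' x) + s (res_d P j x).
    by rewrite s'E /= subrK.
  exists s'; split=> // x; apply/res_exact.
  by rewrite linearB uE s'E res_dd linear0 addr0 subrr.
by exists s; rewrite s0'; split=> // x; rewrite s0E.
Qed.

End Comparison.

Section Tensors.
Variable A : comNzRingType.

Lemma tensor_ext (U V T X : lmodType A) (t : {bilinear U -> V -> T})
    (g g' : {linear T -> X}) :
  is_tensor t -> (forall u v, g (t u v) = g' (t u v)) -> forall x, g x = g' x.
Proof.
move=> tT gg'.
have f_bil : bilinear_for *:%R *:%R (fun u v => g (t u v)).
  by split=> [v|u] a x y /=; rewrite ?linearPl ?linearPr linearP.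
pose f : {bilinear U -> V -> X} := HB.pack (fun u v => g (t u v))
  (bilinear_isBilinear.Build A U V X *:%R *:%R (fun u v => g (t u v)) f_bil).
have [h [_ h_uniq]] := tT X f => x.
by rewrite (h_uniq g) // (h_uniq g') // => u v; rewrite -gg'.
Qed.

Lemma tensor_map (U U' V T T' : lmodType A) (t : {bilinear U -> V -> T})
    (t' : {bilinear U' -> V -> T'}) (h : {linear U -> U'}) :
  is_tensor t -> exists g : {linear T -> T'}, forall u v, g (t u v) = t' (h u) v.
Proof.
move=> tT.
have f_bil : bilinear_for *:%R *:%R (fun u v => t' (h u) v).
  by split=> [v|u] a x y /=; rewrite ?linearP ?linearPl ?linearPr.
pose f : {bilinear U -> V -> T'} := HB.pack (fun u v => t' (h u) v)
  (bilinear_isBilinear.Build A U V T' *:%R *:%R (fun u v => t' (h u) v) f_bil).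
by have [g [gE _]] := tT T' f; exists g.
Qed.

End Tensors.

Section HomologyTransport.
Variables (A : comNzRingType) (C C' : nat -> lmodType A).
Variables (D : forall j, {linear C j.+1 -> C j}) (D' : forall j, {linear C' j.+1 -> C' j}).
Variables (F : forall j, {linear C j -> C' j}) (G : forall j, {linear C' j -> C j}).
Variables (S : forall j, {linear C j -> C j.+1}) (S' : forall j, {linear C' j -> C' j.+1}).
Hypothesis FD : forall j x, D' j (F j.+1 x) = F j (D j x).
Hypothesis GD : forall j x, D j (G j.+1 x) = G j (D' j x).
Hypothesis S0 : forall x, G 0 (F 0 x) - x = D 0 (S 0 x).
Hypothesis SS : forall j x, G j.+1 (F j.+1 x) - x = D j.+1 (S j.+1 x) + S j (D j x).
Hypothesis S'0 : forall x, F 0 (G 0 x) - x = D' 0 (S' 0 x).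
Hypothesis SS' : forall j x, F j.+1 (G j.+1 x) - x = D' j.+1 (S' j.+1 x) + S' j (D' j x).

(** A homotopy equivalence carries the copy [H] of the homology to the other complex: a cycle [z] is
    sent to the class of [F z]. Degree zero is separate because the homotopy has no second term
    there. *)
Lemma is_homology_transport i H : is_homology D' i H -> is_homology D i H.
Proof.
have FZ z : is_cycle D z -> is_cycle D' (F i z).
  by case: i z => // j z /= Dz; rewrite FD Dz linear0.
have GZ z : is_cycle D' z -> is_cycle D (G i z).
  by clear FZ; case: i z => // j z /= Dz; rewrite GD Dz linear0.
have GF z : is_cycle D z -> exists b, D i b = G i (F i z) - z.
  clear FZ GZ; case: i z => [|j] z /= Dz; first by exists (S 0 z).
  by exists (S j.+1 z); rewrite SS Dz linear0 addr0.
have FG z : is_cycle D' z -> exists b, D' i b = F i (G i z) - z.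
  clear FZ GZ GF; case: i z => [|j] z /= Dz; first by exists (S' 0 z).
  by exists (S' j.+1 z); rewrite SS' Dz linear0 addr0.
case=> Z' [inc' [pr' [inc'_inj cycP pr'_surj pr'P]]].
have subZ : submodule (fun z => is_cycle D (i := i) z).
  case: (i) => [|j]; split=> //= [|a x y Dx Dy]; first exact: linear0.
  by rewrite linearP Dx Dy scaler0 addr0.
have pr'_eq c c' b : inc' c - inc' c' = D' i b -> pr' c = pr' c'.
  move=> cE; apply/eqP; rewrite -subr_eq0 -linearB; apply/eqP/pr'P.
  by exists b; rewrite linearB cE.
have [z|a u u' v v' [c cE <-] [c' c'E <-]|v [c cE <-]|pr prE] :=
    @linear_of_rel A (subm subZ) H (fun z h => exists2 c, inc' c = F i (val z) & pr' c = h).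
- have /cycP[c cE] := FZ _ (subm_valQ z).
  by exists (pr' c), c.
- by exists (a *: c + c'); rewrite linearP ?cE ?c'E // -linearP; congr (F i _); rewrite linearP.
- by apply/pr'P; exists 0; rewrite linear0 cE linear0.
exists (subm subZ), val, pr; split.
- exact: val_inj.
- move=> z; split=> [zZ|[c <-]]; last exact: subm_valQ.
  by have [c <-] := subm_surj subZ zZ; exists c.
- move=> h; have [c' <-] := pr'_surj h.
  have c'Z : is_cycle D' (inc' c') by apply/cycP; exists c'.
  have [z zE] := subm_surj subZ (GZ _ c'Z); exists z; apply/esym/prE.
  have /cycP[c cE] := FZ _ (subm_valQ z); exists c => //.
  by have [b bE] := FG _ c'Z; apply: (pr'_eq _ _ b); rewrite cE zE bE.
move=> z; split=> [pr0|[b bE]].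
  have /prE[c cE /pr'P[b bE]] : 0 = pr z by [].
  have [b' b'E] := GF _ (subm_valQ z).
  by exists (G i.+1 b - b'); rewrite linearB GD bE cE b'E opprB addrC subrK.
apply/esym/prE; have /cycP[c cE] := FZ _ (subm_valQ z); exists c => //.
by apply/pr'P; exists (F i.+1 b); rewrite FD bE cE.
Qed.

End HomologyTransport.

(** Comparison maps in both directions, and the homotopies from their composites to the identity,
    survive tensoring. The unknown resolution inside [is_Tor] can thus be exchanged for the one at
    hand. *)
Lemma Tor_homology (A : comNzRingType) (L M H : lmodType A) i
    (P : projective_resolution L) (C : nat -> lmodType A)
    (t : forall j, {bilinear P j -> M -> C j}) (D : forall j, {linear C j.+1 -> C j}) :
  (forall j, is_tensor (t j)) ->
  (forall j x y, D j (t j.+1 x y) = t j (res_d P j x) y) ->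
  is_Tor i L M H -> is_homology D i H.
Proof.
move=> tT tD [P' [C' [t' [D' [t'T t'D hom]]]]].
have tensor_chain (P1 P2 : projective_resolution L) (C1 C2 : nat -> lmodType A)
    (t1 : forall j, {bilinear P1 j -> M -> C1 j}) (t2 : forall j, {bilinear P2 j -> M -> C2 j})
    (D1 : forall j, {linear C1 j.+1 -> C1 j}) (D2 : forall j, {linear C2 j.+1 -> C2 j})
    (f : forall j, {linear P1 j -> P2 j}) :
    (forall j, is_tensor (t1 j)) ->
    (forall j x y, D1 j (t1 j.+1 x y) = t1 j (res_d P1 j x) y) ->
    (forall j x y, D2 j (t2 j.+1 x y) = t2 j (res_d P2 j x) y) ->
    (forall j x, res_d P2 j (f j.+1 x) = f j (res_d P1 j x)) ->
    exists F : forall j, {linear C1 j -> C2 j},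
      (forall j u v, F j (t1 j u v) = t2 j (f j u) v) /\
      forall j x, D2 j (F j.+1 x) = F j (D1 j x).
  move=> t1T t1D t2D fE.
  have Fc j := cid (tensor_map (t2 j) (f j) (t1T j)).
  pose F j := sval (Fc j); have FE j : forall u v, F j (t1 j u v) = _ := svalP (Fc j).
  exists F; split=> // j.
  apply: (tensor_ext (g := D2 j \o F j.+1) (g' := F j \o D1 j) (t1T j.+1)) => u v /=.
  by rewrite FE t2D t1D FE fE.
have tensor_homotopy (P1 P2 : projective_resolution L) (C1 C2 : nat -> lmodType A)
    (t1 : forall j, {bilinear P1 j -> M -> C1 j}) (t2 : forall j, {bilinear P2 j -> M -> C2 j})
    (D1 : forall j, {linear C1 j.+1 -> C1 j}) (D2 : forall j, {linear C2 j.+1 -> C2 j})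
    (f : forall j, {linear P1 j -> P2 j}) (g : forall j, {linear P2 j -> P1 j})
    (F : forall j, {linear C1 j -> C2 j}) (G : forall j, {linear C2 j -> C1 j}) :
    (forall j, is_tensor (t1 j)) ->
    (forall j x y, D1 j (t1 j.+1 x y) = t1 j (res_d P1 j x) y) ->
    (forall x, res_aug P2 (f 0%N x) = res_aug P1 x) ->
    (forall x, res_aug P1 (g 0%N x) = res_aug P2 x) ->
    (forall j x, res_d P2 j (f j.+1 x) = f j (res_d P1 j x)) ->
    (forall j x, res_d P1 j (g j.+1 x) = g j (res_d P2 j x)) ->
    (forall j u v, F j (t1 j u v) = t2 j (f j u) v) ->
    (forall j u v, G j (t2 j u v) = t1 j (g j u) v) ->
    exists S : forall j, {linear C1 j -> C1 j.+1},
      (forall x, G 0 (F 0 x) - x = D1 0 (S 0 x)) /\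
      forall j x, G j.+1 (F j.+1 x) - x = D1 j.+1 (S j.+1 x) + S j (D1 j x).
  move=> t1T t1D f0 g0 fE gE FE GE.
  have [|j x|s [s0 sE]] := @homotopy A L P1 P1 (fun j => (g j \o f j) \- idfun).
  - by move=> x; rewrite linearB /= g0 f0 subrr.
  - by rewrite linearB /= gE fE.
  have Sc j := cid (tensor_map (t1 j.+1) (s j) (t1T j)).
  pose S j := sval (Sc j); have SE j : forall u v, S j (t1 j u v) = _ := svalP (Sc j).
  exists S; split=> [|j].
    apply: (tensor_ext (g := (G 0 \o F 0) \- idfun) (g' := D1 0 \o S 0) (t1T 0)) => u v /=.
    by rewrite FE GE SE t1D -s0 /= linearBl.
  apply: (tensor_ext (g := (G j.+1 \o F j.+1) \- idfun)
    (g' := (D1 j.+1 \o S j.+1) \+ (S j \o D1 j)) (t1T j.+1)) => u v /=.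
  by rewrite FE GE !SE !t1D SE -linearDl -sE /= linearBl.
have [f [f0 fE]] := comparison P P'; have [g [g0 gE]] := comparison P' P.
have [F [FE FD]] := tensor_chain _ _ _ _ _ t' _ _ f tT tD t'D fE.
have [G [GE GD]] := tensor_chain _ _ _ _ _ t _ _ g t'T t'D tD gE.
have [S [S0 SS]] := tensor_homotopy _ _ _ _ _ _ D D' f g F G tT tD f0 g0 fE gE FE GE.
have [S' [S'0 SS']] := tensor_homotopy _ _ _ _ _ _ D' D g f G F t'T t'D g0 f0 gE fE GE FE.
exact: (@is_homology_transport A C C' D D' F G S S' FD GD S0 SS S'0 SS' i H hom).
Qed.

(** * Presentations of homology and Tor *)

Section HomologyPresentation.
Variable A : comNzRingType.

(** The terms of the complex are free modules modulo the rows of [N] and [N0]. The conditions say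
    that the rows of [Z] are cycles, that their classes generate the homology, and that [rel]
    generates the relations between these classes. *)
Definition homology_presentation e0 n0 e n e1 g r (d0 : 'M[A]_(e, e0))
    (N0 : 'M[A]_(n0, e0)) (d : 'M[A]_(e1, e)) (N : 'M[A]_(n, e))
    (Z : 'M[A]_(g, e)) (rel : 'M[A]_(r, g)) : Prop :=
  [/\ factors (Z *m d0) N0,
      forall z : 'rV_e, factors (z *m d0) N0 -> factors z (col_mx Z (col_mx d N)) &
      forall y : 'rV_g, factors (y *m Z) (col_mx d N) <-> factors y rel].

(** The preimage of a row space comes from a kernel: [z V = y W] means that [(z, -y)] is a relation
    of [V] stacked on [W]. *)
Lemma factors_lsubmx s r w c (K : 'M[A]_(s, r + w)) (V : 'M_(r, c)) (W : 'M_(w, c)) :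
  exact_mx K (col_mx V W) ->
  forall z : 'rV_r, factors (z *m V) W <-> factors z (lsubmx K).
Proof.
move=> [KVW KP] z; split=> [[y zy]|[y ->]].
  have [|x /(congr1 lsubmx)] := KP (row_mx z (- y)).
    by rewrite mul_row_col zy mulNmx subrr.
  by rewrite row_mxKl -mulmx_lsub; exists x.
exists (- (y *m rsubmx K)); apply/eqP; rewrite -subr_eq0 mulNmx opprK -!mulmxA -mulmxDr.
by rewrite -mul_row_col hsubmxK KVW mulmx0.
Qed.

End HomologyPresentation.

(** Kernels [K1] and [K2] that are exact at almost all points turn the conditions on all vectors
    into inclusions of row spaces, which spread from the generic point. *)
Lemma homology_presentation_generically (Lam : idomainType) (X : ringfam Lam)
    e0 n0 e n e1 g r (d0 : 'M[X]_(e, e0)) (N0 : 'M[X]_(n0, e0)) (d : 'M[X]_(e1, e))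
    (N : 'M[X]_(n, e)) (Z : 'M[X]_(g, e)) (rel : 'M[X]_(r, g)) :
  let hp p := homology_presentation (map_mx (fam_ev X p) d0) (map_mx (fam_ev X p) N0)
      (map_mx (fam_ev X p) d) (map_mx (fam_ev X p) N) (map_mx (fam_ev X p) Z)
      (map_mx (fam_ev X p) rel) in
  syzygetic X -> hp (generic_pt Lam) -> generically hp.
Proof.
move=> hp synX [].
have [k1 [K1 exK1]] := syzygetic_ker synX (col_mx d0 N0).
have [k2 [K2 exK2]] := syzygetic_ker synX (col_mx Z (col_mx d N)).
have K1P p : exact_mx (map_mx (fam_ev X p) K1) (map_mx (fam_ev X p) (col_mx d0 N0)) ->
    forall z : 'rV_e, factors (z *m map_mx (fam_ev X p) d0) (map_mx (fam_ev X p) N0) <->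
      factors z (map_mx (fam_ev X p) (lsubmx K1)).
  by rewrite map_col_mx map_lsubmx; apply: factors_lsubmx.
have K2P p : exact_mx (map_mx (fam_ev X p) K2) (map_mx (fam_ev X p) (col_mx Z (col_mx d N))) ->
    forall y : 'rV_g, factors (y *m map_mx (fam_ev X p) Z)
        (col_mx (map_mx (fam_ev X p) d) (map_mx (fam_ev X p) N)) <->
      factors y (map_mx (fam_ev X p) (lsubmx K2)).
  by rewrite !map_col_mx map_lsubmx; apply: factors_lsubmx.
have K1g := K1P _ (generically_generic exK1); have K2g := K2P _ (generically_generic exK2).
rewrite -map_mxM => /factors_generically g1 g2 g3.
have /factors_generically {}g2 : factors (map_mx (fam_ev X (generic_pt Lam)) (lsubmx K1))
    (map_mx (fam_ev X (generic_pt Lam)) (col_mx Z (col_mx d N))).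
  rewrite !map_col_mx; apply: factors_row => i; apply: g2; apply/K1g.
  by exists (delta_mx 0 i); rewrite rowE.
have /factors_generically g3a : factors (map_mx (fam_ev X (generic_pt Lam)) (lsubmx K2))
    (map_mx (fam_ev X (generic_pt Lam)) rel).
  apply: factors_row => i; apply/g3/K2g.
  by exists (delta_mx 0 i); rewrite rowE.
have /factors_generically g3b : factors (map_mx (fam_ev X (generic_pt Lam)) rel)
    (map_mx (fam_ev X (generic_pt Lam)) (lsubmx K2)).
  apply: factors_row => i; apply/K2g/g3.
  by exists (delta_mx 0 i); rewrite rowE.
apply: generically_imp (generically_and (generically_and exK1 exK2)
  (generically_and (generically_and g1 g2) (generically_and g3a g3b))).
move=> p [[/K1P {}K1P /K2P {}K2P] [[{}g1 {}g2] [{}g3a {}g3b]]]; split.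
- by rewrite -map_mxM.
- by move=> z /K1P zK; rewrite -!map_col_mx; apply: factors_trans zK g2.
move=> y; split=> [/K2P yK|yrel]; first exact: factors_trans yK g3a.
by apply/K2P/(factors_trans yrel).
Qed.

Section PresentedComplex.
Variables (A : comNzRingType) (C : nat -> lmodType A) (D : forall j, {linear C j.+1 -> C j}).
Variables (e n : nat -> nat) (pi : forall j, {linear 'rV[A]_(e j) -> C j}).
Variables (N : forall j, 'M[A]_(n j, e j)) (d : forall j, 'M[A]_(e j.+1, e j)).
Hypothesis pi_surj : forall j, surjective (pi j).
Hypothesis pi_ker : forall j z, pi j z = 0 <-> factors z (N j).
Hypothesis pi_D : forall j z, D j (pi j.+1 z) = pi j (z *m d j).

Definition prev_dim (e : nat -> nat) i := if i is j.+1 then e j else 0%N.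

(* For [i = 0] the target of the differential out of degree [i] is [0]. *)
Definition prev_d i : 'M[A]_(e i, prev_dim e i) :=
  match i with 0 => 0 | j.+1 => d j end.

Definition prev_rel i : 'M[A]_(prev_dim n i, prev_dim e i) :=
  match i with 0 => 0 | j.+1 => N j end.

Fact cycle_factors i z :
  is_cycle D (pi i z) <-> factors (z *m prev_d i) (prev_rel i).
Proof.
case: i z => [|j] z /=; last by rewrite pi_D pi_ker.
by split=> // _; exists 0; rewrite mul0mx mulmx0.
Qed.

Fact boundary_factors i z :
  (exists b, D i b = pi i z) <-> factors z (col_mx (d i) (N i)).
Proof.
rewrite factors_col_split; split=> [[b bE]|[y [w ->]]].
  have [y yE] := pi_surj b; subst b; exists y.
  have /pi_ker[w wE] : pi i (z - y *m d i) = 0 by rewrite linearB -pi_D bE subrr.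
  by exists w; rewrite -wE addrC subrK.
exists (pi i.+1 y); rewrite pi_D linearD.
by rewrite (_ : pi i (w *m N i) = 0) ?addr0 //; apply/pi_ker; exists w.
Qed.

(** Each generator of [T] is lifted to a cycle and the cycle to a row vector; these vectors are the
    rows of [Z]. *)
Lemma homology_presentation_exists i (T : lmodType A) (DT : presentation A) :
  is_homology D i T -> presents DT T ->
  exists Z, homology_presentation (prev_d i) (prev_rel i) (d i) (N i) Z (rel_mx DT).
Proof.
move=> [Y [inc [pr [inc_inj cycP pr_surj prP]]]] [p [p_surj pP]].
have /choice[zc zcP] : forall k, exists zc : 'rV_(e i) * Y,
    pi i zc.1 = inc zc.2 /\ pr zc.2 = p (delta_mx 0 k).
  move=> k; have [c cE] := pr_surj (p (delta_mx 0 k)).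
  by have [z zE] := pi_surj (inc c); exists (z, c).
pose Z := \matrix_k (zc k).1; pose lift (y : 'rV_(gens DT)) := \sum_k y 0 k *: (zc k).2.
have piZ y : pi i (y *m Z) = inc (lift y).
  rewrite mulmx_sum_row !linear_sum; apply: eq_bigr => k _.
  by rewrite !linearZ rowK /= (zcP k).1.
have pr_lift y : pr (lift y) = p y.
  rewrite [in RHS](row_sum_delta y) !linear_sum; apply: eq_bigr => k _.
  by rewrite !linearZ /= (zcP k).2.
exists Z; split.
- apply: factors_rows => x; rewrite mulmxA; apply/cycle_factors.
  by rewrite piZ; apply/cycP; exists (lift x).
- move=> z /cycle_factors/cycP[c cE]; have [y yE] := p_surj (pr c).
  have /prP[b bE] : pr (c - lift y) = 0 by rewrite linearB pr_lift yE subrr.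
  rewrite -[z](subrK (y *m Z)); apply: factorsD.
    apply: factors_cold; apply/boundary_factors; exists b.
    by rewrite bE !linearB /= cE piZ.
  by apply: factors_colu; exists y.
move=> y; rewrite -boundary_factors piZ; split=> [/prP|[w wE]].
  by rewrite pr_lift => /pP[w <-]; exists w.
by apply/prP; rewrite pr_lift; apply/pP; exists w.
Qed.

(** The class of a cycle is [p y] for any [y] such that [y Z] differs from the cycle by a boundary;
    the third condition makes this independent of [y]. *)
Lemma homology_presentation_homology i (T : lmodType A) (DT : presentation A) Z :
  homology_presentation (prev_d i) (prev_rel i) (d i) (N i) Z (rel_mx DT) ->
  presents DT T -> is_homology D i T.
Proof.
move=> [Zcyc Zgen Zrel] [p [p_surj pP]].
have subZ : submodule (fun z => is_cycle D (i := i) z).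
  case: (i) => [|j]; split=> //= [|a x y Dx Dy]; first exact: linear0.
  by rewrite linearP Dx Dy scaler0 addr0.
have boundaryZ y : (exists b, D i b = pi i (y *m Z)) <-> p y = 0.
  rewrite boundary_factors Zrel pP.
  by split=> -[w]; exists w.
pose R (z : subm subZ) q :=
  exists y, p y = q /\ exists b, D i b = val z - pi i (y *m Z).
have [z|a u u' v v' [y [<- [b bE]]] [y' [<- [b' b'E]]]|v [y [<- [b bE]]]|pr prE] :=
    @linear_of_rel A (subm subZ) T R.
- have [x xE] := pi_surj (val z).
  have /Zgen/factors_col_split[y [w wE]] : factors (x *m prev_d i) (prev_rel i).
    by apply/cycle_factors; rewrite xE; apply: subm_valQ.
  exists (p y), y; split=> //; rewrite -xE wE linearD addrC addKr.
  by apply/boundary_factors; exists w.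
- exists (a *: y + y'); split; first by rewrite linearP.
  have -> : val (a *: u + u') = a *: val u + val u' by rewrite linearP.
  exists (a *: b + b'); rewrite linearP bE b'E mulmxDl -scalemxAl linearP.
  by rewrite scalerBr opprD addrACA.
- apply/boundaryZ; exists (- b); rewrite linearN bE raddf0 sub0r opprK //.
have cycZ y : is_cycle D (pi i (y *m Z)).
  by apply/cycle_factors; rewrite -mulmxA; apply: factors_mull.
exists (subm subZ), val, pr; split.
- exact: val_inj.
- move=> z; split=> [zZ|[c <-]]; last exact: subm_valQ.
  by have [c <-] := subm_surj subZ zZ; exists c.
- move=> h; have [y <-] := p_surj h; have [z zE] := subm_surj subZ (cycZ y).
  exists z; apply/esym/prE; exists y; split=> //; exists 0.
  by rewrite linear0 zE subrr.
move=> z; split=> [pr0|zb].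
  have /prE[y [/boundaryZ[b bE] [b' b'E]]] : 0 = pr z by [].
  by exists (b' + b); rewrite linearD b'E bE subrK.
by apply/esym/prE; exists 0; rewrite linear0 mul0mx linear0 subr0.
Qed.

End PresentedComplex.

Section MatrixResolution.
Variables (A : comNzRingType) (L : lmodType A) (a : nat -> nat).
Variables (P : forall j, 'M[A]_(a j.+1, a j)) (p : {linear 'rV[A]_(a 0) -> L}).
Hypothesis p_surj : surjective p.
Hypothesis p_ker : forall x, p x = 0 <-> factors x (P 0).
Hypothesis P_exact : forall j, exact_mx (P j.+1) (P j).

Definition mx_resolution : projective_resolution L.
Proof.
refine (@ProjectiveResolution A L (fun j => 'rV[A]_(a j)) (fun j => mulmxr (P j)) p
  (fun j => @row_projective A (a j)) p_surj _ _).
- by move=> x; rewrite p_ker; split=> -[y]; exists y.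
- move=> j x; have [PP Pker] := P_exact j.
  split=> [/Pker[y ->]|[y <-]]; first by exists y.
  by rewrite /= -mulmxA PP mulmx0.
Defined.

End MatrixResolution.

(** * Tensoring a free complex with a presented module *)

Section FreeComplex.
Variables (A : comNzRingType) (M : lmodType A) (a : nat -> nat).
Variable P : forall j, 'M[A]_(a j.+1, a j).
Variables (b r : nat) (N : 'M[A]_(r, b)) (q : {linear 'rV[A]_b -> M}).
Hypothesis q_surj : surjective q.
Hypothesis q_ker : forall x, q x = 0 <-> factors x N.

(** The tensor product of [A^a] and [M], modelled by [M^a]. *)
Definition free_tensor j : lmodType A := {ffun 'I_(a j) -> M}.

Definition free_pure j (v : 'rV[A]_(a j)) (x : M) : free_tensor j :=
  [ffun i => v 0 i *: x].

Fact free_pure_bilinear j : bilinear_for *:%R *:%R (@free_pure j).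
Proof.
split=> [x|v] c y z; apply/ffunP=> i; rewrite !ffunE /=.
  by rewrite !mxE scalerDl scalerA.
by rewrite scalerDr !scalerA mulrC.
Qed.

HB.instance Definition _ j := bilinear_isBilinear.Build A 'rV[A]_(a j) M (free_tensor j)
  *:%R *:%R (@free_pure j) (free_pure_bilinear j).

Definition free_d j (x : free_tensor j.+1) : free_tensor j :=
  [ffun i => \sum_l P j l i *: (x : {ffun _ -> _}) l].

Fact free_d_linear j : linear (@free_d j).
Proof.
move=> c x y; apply/ffunP=> i; rewrite !ffunE scaler_sumr -big_split.
by apply: eq_bigr => l _; rewrite !ffunE scalerDr !scalerA mulrC.
Qed.

HB.instance Definition _ j := GRing.isLinear.Build A (free_tensor j.+1) (free_tensor j)
  *:%R (@free_d j) (@free_d_linear j).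

Definition free_pi j (z : 'rV[A]_(a j * b)) : free_tensor j :=
  [ffun i => q (row i (vec_mx z))].

Fact free_pi_linear j : linear (@free_pi j).
Proof. by move=> c x y; apply/ffunP=> i; rewrite !ffunE !linearP. Qed.

HB.instance Definition _ j := GRing.isLinear.Build A 'rV[A]_(a j * b) (free_tensor j)
  *:%R (@free_pi j) (@free_pi_linear j).

(** The tensor product of [A^a] and [A^b] is modelled by [a]-by-[b] matrices flattened with [mxvec].
    The differential acts on the row index, whence the transpose, and the relations of [M] act on
    the column index. *)
Definition free_d_mx j : 'M[A]_(a j.+1 * b, a j * b) := lin_mx (mulmx (P j)^T).
Definition free_rel_mx j : 'M[A]_(a j * r, a j * b) := lin_mx (mulmxr N).

Lemma free_tensorP j : is_tensor (@free_pure j).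
Proof.
move=> X f; pose g (x : free_tensor j) := \sum_i f (delta_mx 0 i) ((x : {ffun _ -> _}) i).
have g_lin : linear g.
  move=> c x y; rewrite /g scaler_sumr -big_split; apply: eq_bigr => i _.
  by rewrite !ffunE linearPr.
pose G : {linear free_tensor j -> X} := HB.pack g (GRing.isLinear.Build A _ _ *:%R g g_lin).
exists G; split=> [v x|g' g'E x].
  rewrite /= /g [in RHS](row_sum_delta v) linear_sumlz; apply: eq_bigr => i _.
  by rewrite ffunE linearZr_LR linearZl_LR.
have {1}-> : x = \sum_i free_pure (delta_mx 0 i) ((x : {ffun _ -> _}) i).
  apply/ffunP=> l; rewrite sum_ffunE (bigD1 l) //= ffunE mxE !eqxx scale1r.
  rewrite big1 ?addr0 // => i neq_il.
  by rewrite ffunE mxE eq_sym (negPf neq_il) scale0r.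
by rewrite linear_sum; apply: eq_bigr => i _; rewrite g'E.
Qed.

Lemma free_d_pure j (v : 'rV[A]_(a j.+1)) x :
  free_d (free_pure v x) = free_pure (v *m P j) x.
Proof.
apply/ffunP=> i; rewrite !ffunE mxE scaler_suml; apply: eq_bigr => l _.
by rewrite ffunE scalerA mulrC.
Qed.

Lemma free_pi_surj j : surjective (@free_pi j).
Proof.
move=> x; have [s sK] := choice q_surj.
exists (mxvec (\matrix_i s ((x : {ffun _ -> _}) i))).
by apply/ffunP=> i; rewrite ffunE mxvecK rowK sK.
Qed.

Lemma free_pi_ker j (z : 'rV[A]_(a j * b)) :
  free_pi z = 0 <-> factors z (free_rel_mx j).
Proof.
split=> [/ffunP z0|[y ->]].
  have [C CE] : factors (vec_mx z) N.
    by apply: factors_row => i; apply/q_ker; have := z0 i; rewrite !ffunE.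
  by exists (mxvec C); rewrite /free_rel_mx mul_vec_lin /= -CE vec_mxK.
apply/ffunP=> i; rewrite !ffunE /free_rel_mx mul_rV_lin mxvecK /= row_mul.
by apply/q_ker; exists (row i (vec_mx y)).
Qed.

Lemma free_d_pi j (z : 'rV[A]_(a j.+1 * b)) :
  free_d (free_pi z) = free_pi (z *m free_d_mx j).
Proof.
apply/ffunP=> i; rewrite !ffunE /free_d_mx mul_rV_lin mxvecK /= row_mul.
rewrite mulmx_sum_row linear_sum; apply: eq_bigr => l _.
by rewrite ffunE linearZ !mxE.
Qed.

End FreeComplex.

Lemma map_free_d_mx (A B : comNzRingType) (f : {rmorphism A -> B}) (a : nat -> nat)
    (P : forall j, 'M[A]_(a j.+1, a j)) b j :
  map_mx f (free_d_mx P b j) = free_d_mx (fun j => map_mx f (P j)) b j.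
Proof.
apply: map_lin_mx => v; rewrite /= map_mxM; congr (_ *m _).
by rewrite map_trmx.
Qed.

Lemma map_free_rel_mx (A B : comNzRingType) (f : {rmorphism A -> B}) (a : nat -> nat)
    r b (N : 'M[A]_(r, b)) j :
  map_mx f (free_rel_mx a N j) = free_rel_mx a (map_mx f N) j.
Proof. by apply: map_lin_mx => v; rewrite /= map_mxM. Qed.

Section TorPresentation.
Variables (A : comNzRingType) (L M : lmodType A) (a : nat -> nat).
Variables (P : forall j, 'M[A]_(a j.+1, a j)) (p : {linear 'rV[A]_(a 0) -> L}).
Variables (b r : nat) (N : 'M[A]_(r, b)) (q : {linear 'rV[A]_b -> M}).
Hypotheses (p_surj : surjective p) (q_surj : surjective q).
Hypothesis p_ker : forall x, p x = 0 <-> factors x (P 0).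
Hypothesis q_ker : forall x, q x = 0 <-> factors x N.
Hypothesis P_exact : forall j, exact_mx (P j.+1) (P j).

Definition Tor_presentation i (DT : presentation A) Z : Prop :=
  homology_presentation (prev_d (free_d_mx P b) i) (prev_rel (free_rel_mx a N) i)
    (free_d_mx P b i) (free_rel_mx a N i) Z (rel_mx DT).

Lemma Tor_free_homology i T : is_Tor i L M T <->
  is_homology (fun j => free_d P (j := j) : {linear free_tensor M a j.+1 -> free_tensor M a j}) i T.
Proof.
split=> [|hom].
  apply: (@Tor_homology _ _ _ _ _ (mx_resolution p_surj p_ker P_exact) (free_tensor M a)
    (fun j => @free_pure _ _ _ j)) => [j|j x y]; first exact: free_tensorP.
  exact: free_d_pure.
exists (mx_resolution p_surj p_ker P_exact), (free_tensor M a),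
  (fun j => @free_pure _ _ _ j), (fun j => @free_d _ _ _ P j);
  split=> // j; first exact: free_tensorP.
by move=> x y; apply: free_d_pure.
Qed.

(** With its converse [Tor_presentation_Tor], this reduces the question of which modules are [Tor]
    to conditions on matrices. *)
Lemma Tor_presentation_exists i T DT : is_Tor i L M T -> presents DT T ->
  exists Z, Tor_presentation (DT := DT) (i := i) Z.
Proof.
move=> /Tor_free_homology.
apply: (homology_presentation_exists (pi := fun j => @free_pi _ _ a _ q j)).
- by move=> j; apply: free_pi_surj.
- by move=> j z; apply: free_pi_ker.
by move=> j z; apply: free_d_pi.
Qed.

Lemma Tor_presentation_Tor i T DT Z :
  Tor_presentation (DT := DT) (i := i) Z -> presents DT T -> is_Tor i L M T.
Proof.
move=> TP DTT; apply/Tor_free_homology.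
apply: (homology_presentation_homology (pi := fun j => @free_pi _ _ a _ q j)) TP DTT.
- by move=> j; apply: free_pi_surj.
- by move=> j z; apply: free_pi_ker.
by move=> j z; apply: free_d_pi.
Qed.

Lemma Tor_zero i T : a i = 0%N -> is_Tor i L M T <-> zero_module T.
Proof.
move=> ai0; rewrite Tor_free_homology.
have C0 (x y : free_tensor M a i) : x = y.
  by apply/ffunP=> l; have := ltn_ord l; rewrite {2}ai0.
split=> [[Y [inc [pr [inc_inj _ pr_surj _]]]] x|T0].
  have [y <-] := pr_surj x.
  have -> : y = 0 by apply: inc_inj; apply: C0.
  exact: linear0.
exists (free_tensor M a i), idfun, (\0%R : {linear _ -> _}); split=> //.
- move=> z; split=> [_|_]; first by exists z.
  have -> : z = 0 := C0 _ _.
  by case: (i) => //= j; apply: linear0.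
- by move=> x; exists 0; apply/esym/T0.
by move=> c; split=> // _; exists 0; apply: C0.
Qed.

End TorPresentation.

(** * [Tor] at the generic point and at almost all points *)

Section GenericTor.
Variables (Lam : idomainType) (X : ringfam Lam).
Local Notation gen := (generic_pt Lam).
Local Notation "B @ p" := (map_mx (fam_ev X p) B) (at level 30).
Hypothesis synX : syzygetic X.

Definition consn (c : nat) (a : nat -> nat) j := if j is j'.+1 then a j' else c.

(** The finite resolution is continued by zero modules, since projective resolutions are indexed by
    all degrees. The first matrix is compared with [W] through row spaces because its number of rows
    belongs to the chain being constructed. *)
Lemma resolved_chain d w c (W : 'M[X]_(w, c)) : resolved d W ->
  exists (a : nat -> nat) (P : forall j, 'M[X]_(consn c a j.+1, consn c a j)),
  [/\ forall j, (d < j)%N -> a j = 0%N,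
      generically (fun p => factors (W@p) (P 0 @p) /\ factors (P 0 @p) (W@p)) &
      generically (fun p => forall j, exact_mx (P j.+1 @p) (P j @p))].
Proof.
elim: d w c W => [|d IHd] w c W /=.
  move=> injW; pose a := consn w (fun=> 0%N).
  exists a, (fun j => match j return 'M[X]_(consn c a j.+1, consn c a j) with
    0 => W | j.+1 => 0 end); split=> [[]//||].
    by apply: generically_all => p; split; apply: factors_refl.
  apply: generically_imp injW => p injW [|j]; split; try exact: flatmx0.
    by move=> x /injW->; exists 0; rewrite mul0mx.
  by move=> x _; exists 0; rewrite thinmx0 mul0mx.
case=> s [N [exN /IHd[a [P [a0 NP0 exP]]]]].
exists (consn w a), (fun j => match j
    return 'M[X]_(consn c (consn w a) j.+1, consn c (consn w a) j) with
  0 => W | j.+1 => P j end); split=> [[|j]//||]; first exact: a0.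
  by apply: generically_all => p; split; apply: factors_refl.
apply: generically_imp (generically_and exN (generically_and NP0 exP)).
move=> p [{}exN [[NP PN] {}exP]] [|j]; last exact: exP.
exact: exact_mx_eq_left exN NP PN.
Qed.

Lemma presents_eq (A : comNzRingType) g r s (B : 'M[A]_(r, g)) (W : 'M[A]_(s, g))
    (U : lmodType A) :
  factors B W -> factors W B -> presents (Presentation B) U -> presents (Presentation W) U.
Proof.
move=> BW WB [p [p_surj pP]]; exists p; split=> // x; rewrite pP /=.
split=> -[y yE].
  have [|z zE] := @factors_trans _ _ _ _ _ x B W _ BW; first by exists y.
  by exists z.
have [|z zE] := @factors_trans _ _ _ _ _ x W B _ WB; first by exists y.
by exists z.
Qed.

Variables (r c s b : nat) (BL : 'M[X]_(r, c)) (BM : 'M[X]_(s, b)).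
Variables L M : lmodType (fam_fib X gen).
Hypothesis presL : presents (Presentation (BL@gen)) L.
Hypothesis presM : presents (Presentation (BM@gen)) M.

(** The first part costs a scalar in each degree, so it serves finitely many degrees only. The other
    two settle all degrees beyond the length of the resolution, the last one with a single
    scalar. *)
Lemma Tor_generically : exists d,
  [/\ forall i (T : lmodType (fam_fib X gen)) t g (BT : 'M[X]_(t, g)),
        is_Tor i L M T -> presents (Presentation (BT@gen)) T ->
        generically (fun p => forall L' M' T' : lmodType (fam_fib X p),
          presents (Presentation (BL@p)) L' -> presents (Presentation (BM@p)) M' ->
          presents (Presentation (BT@p)) T' -> is_Tor i L' M' T'),
      forall i (T : lmodType (fam_fib X gen)),
        (d < i)%N -> is_Tor i L M T -> zero_module T &
      generically (fun p => forall L' M' : lmodType (fam_fib X p),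
          presents (Presentation (BL@p)) L' -> presents (Presentation (BM@p)) M' ->
        forall i (T' : lmodType (fam_fib X p)),
          (d < i)%N -> zero_module T' -> is_Tor i L' M' T')].
Proof.
have [w [W [d [BW /resolved_chain[a' [P [a0 WP exP]]]]]]] := synX.2 _ _ BL.
pose a := consn c a'.
have BP : generically (fun p => factors (BL@p) (P 0 @p) /\ factors (P 0 @p) (BL@p)).
  apply: generically_imp (generically_and BW WP) => p [[BW' WB] [WP' PW]].
  by split; [apply: factors_trans BW' WP' | apply: factors_trans PW WB].
have rowP (A : comNzRingType) g' t' (B : 'M[A]_(t', g')) (U : lmodType A) :
    presents (Presentation B) U -> exists p : {linear 'rV[A]_g' -> U},
      surjective p /\ forall x, p x = 0 <-> factors x B.
  by case=> p [p_surj pP]; exists p; split=> // x; rewrite pP; split=> -[y yE]; exists y.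
have chainP p L' : factors (BL@p) (P 0 @p) /\ factors (P 0 @p) (BL@p) ->
    presents (Presentation (BL@p)) L' ->
    exists l : {linear 'rV[fam_fib X p]_(a 0) -> L'},
      surjective l /\ forall x, l x = 0 <-> factors x (P 0 @p).
  by case=> BP1 PB1 /(presents_eq BP1 PB1)/rowP.
have [l [l_surj lP]] := chainP gen L (generically_generic BP) presL.
have [q [q_surj qP]] := rowP _ _ _ _ _ presM.
have exPg := generically_generic exP.
(* The ranks [a] are the ranks [a'] shifted by one, so they vanish above [d.+1]. *)
exists d.+1; split=> [i T t g BT TorT presT|i T|].
- have [Z0 TP] := Tor_presentation_exists l_surj q_surj lP qP exPg TorT presT.
  (* Multiplying the cycles by [z], a unit of the generic fibre, affects none of the conditions. *)
  have [z z0 [Z ZE]] := clear_mx Z0.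
  have [|u uz] := @fam_unit _ X gen z; first by rewrite tofrac_eq0.
  pose hp p := homology_presentation
    ((prev_d (free_d_mx P b) i)@p) ((prev_rel (free_rel_mx a BM) i)@p)
    ((free_d_mx P b i)@p) ((free_rel_mx a BM i)@p) (Z@p) (BT@p).
  have hpE p Z' : homology_presentation
      (prev_d (free_d_mx (fun j => P j @p) b) i) (prev_rel (free_rel_mx a (BM@p)) i)
      (free_d_mx (fun j => P j @p) b i) (free_rel_mx a (BM@p) i) Z' (BT@p) <->
    homology_presentation
      ((prev_d (free_d_mx P b) i)@p) ((prev_rel (free_rel_mx a BM) i)@p)
      ((free_d_mx P b i)@p) ((free_rel_mx a BM i)@p) Z' (BT@p).
    rewrite map_free_d_mx map_free_rel_mx.
    have -> : (prev_d (free_d_mx P b) i)@p = prev_d (free_d_mx (fun j => P j @p) b) i.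
      by case: (i) => [|j] /=; [rewrite map_mx0 | rewrite map_free_d_mx].
    have -> // : (prev_rel (free_rel_mx a BM) i)@p = prev_rel (free_rel_mx a (BM@p)) i.
    by case: (i) => [|j] /=; [rewrite map_mx0 | rewrite map_free_rel_mx].
  have hpg : hp gen.
    have [Z1 Z2 Z3] := (hpE _ _).1 TP; rewrite /hp ZE; split.
    - by rewrite -scalemxAl; apply: factorsZ.
    - move=> y /Z2/factors_col_split[v [v' ->]]; apply/factors_col_split.
      by exists (u *: v), v'; rewrite -scalemxAl -scalemxAr scalerA uz scale1r.
    move=> y; rewrite -Z3 -scalemxAr; split; [exact: factors_unit uz | exact: factorsZ].
  have := generically_and (homology_presentation_generically synX hpg) (generically_and BP exP).
  apply: generically_imp => p [/hpE{}TP [{}BP {}exP]] L' M' T' presL' presM' presT'.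
  have [l' [l'_surj l'P]] := chainP p L' BP presL'.
  have [q' [q'_surj q'P]] := rowP _ _ _ _ _ presM'.
  exact: (@Tor_presentation_Tor _ L' M' a (fun j => P j @p) l' _ _ (BM@p) q' l'_surj q'_surj
    l'P q'P exP i T' (Presentation (BT@p)) (Z@p) TP presT').
- case: i => // i; rewrite ltnS => /a0 ai0.
  exact: (@Tor_zero _ L M a (fun j => P j @gen) l l_surj lP exPg i.+1 T ai0).1.
apply: generically_imp (generically_and BP exP) => p [{}BP {}exP] L' M' presL' presM'.
have [l' [l'_surj l'P]] := chainP p L' BP presL'.
move=> [|i] // T'; rewrite ltnS => /a0 ai0 T'0.
exact: (@Tor_zero _ L' M' a (fun j => P j @p) l' l'_surj l'P exP i.+1 T' ai0).2.
Qed.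

End GenericTor.

(** * Specialization at almost all points *)

Section AlmostAllPoints.
Variables (k K : fieldType) (iota : {rmorphism k -> K}).
Hypothesis k_infinite : forall s : seq k, exists c, c \notin s.

Lemma meval_muni m (q : {mpoly k[m.+1]}) (c : 'I_m -> k) x :
  q.@[fun i => if unlift ord_max i is Some j then c j else x] =
  (map_poly (meval c) (muni q)).[x].
Proof.
rewrite [in LHS](mpolyE q) muniE !raddf_sum horner_sum; apply: eq_bigr => mon _ /=.
rewrite mevalZ mevalX map_polyZ hornerZ map_polyXn hornerXn /= mevalZ mevalX -mulrA.
congr (_ * _); rewrite big_ord_recr /= unlift_none; congr (_ * _).
apply: eq_bigr => j _; rewrite mnmE.
have -> : widen_ord (leqnSn m) j = lift ord_max j.
  by apply: val_inj; rewrite /= /bump leqNgt ltn_ord.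
by rewrite liftK.
Qed.

(** The leading coefficient in the last variable is nonzero at some [c]; the resulting polynomial in
    one variable has finitely many roots, and these do not exhaust [k]. *)
Lemma mpoly_nonroot m (q : {mpoly k[m]}) : q != 0 -> exists c, q.@[c] != 0.
Proof.
elim: m q => [|m IHm] q q0.
  exists (fun=> 0); apply: contraNneq q0 => qe.
  apply/eqP/mpolyP=> mon; rewrite mcoeff0 -qe (mpolyE q) !raddf_sum.
  apply: eq_bigr => mon' _ /=; rewrite mcoeffZ mcoeffX mevalZ mevalX big_ord0.
  by rewrite (_ : mon' = mon) ?eqxx //; apply/mnmP=> -[].
have : muni q != 0.
  by apply: contraNneq q0 => mq0; apply/eqP/(bij_inj (muni_bij m k)); rewrite mq0 raddf0.
rewrite -lead_coef_eq0 => /IHm[c c0].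
have mq0 : map_poly (meval c) (muni q) != 0.
  by apply: contraNneq c0 => /polyP/(_ (size (muni q)).-1); rewrite coef_map coef0 => ->.
have [rs rsP] : exists rs : seq k, forall x, root (map_poly (meval c) (muni q)) x -> x \in rs.
  move: (map_poly _ _) mq0 => p p0.
  have [n] := ubnP (size p); elim: n p p0 => // n IHn p p0 ltpn.
  have [[x px]|nroot] := pselect (exists x, root p x); last first.
    by exists [::] => x px; case: nroot; exists x.
  have [p' pE] := factor_theorem p x px.
  have p'0 : p' != 0 by apply: contraNneq p0 => p'0; rewrite pE p'0 mul0r.
  have [|rs rsP] := IHn p' p'0.
    by move: ltpn; rewrite pE size_Mmonic ?monicXsubC // size_XsubC addn2.
  exists (x :: rs) => y; rewrite pE rootM root_XsubC inE orbC.
  by case/orP=> [->//|/rsP->]; rewrite orbT.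
have [x xP] := k_infinite rs.
exists (fun i => if unlift ord_max i is Some j then c j else x).
by rewrite meval_muni; apply: contra xP => /rsP.
Qed.

Lemma eval_at_val m (alpha : 'I_m -> K) (q : {mpoly k[m]}) :
  val (eval_at iota alpha q) = (map_mpoly iota q).@[alpha].
Proof.
rewrite /eval_at /map_mpoly /mmap !raddf_sum; apply: eq_bigr => mon _ /=.
rewrite mevalM mevalC; congr (_ * _); rewrite /mmap1 rmorph_prod -[LHS]/(val _).
rewrite rmorph_prod; apply: eq_bigr => i _.
by rewrite !rmorphXn /= mevalXU.
Qed.

Definition alpha_pt m (alpha : 'I_m -> K) : point {mpoly k[m]} :=
  Point (eval_at iota alpha : {rmorphism _ -> _}).

(** The exceptional set is the zero set of the image of [q], which is proper because [q] is nonzero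
    at some point with coordinates in [k]. *)
Lemma generically_almost_all m (P : point {mpoly k[m]} -> Prop) :
  generically P -> almost_all (fun alpha => P (alpha_pt alpha)).
Proof.
case=> q q0 Pq; exists (fun alpha => (map_mpoly iota q).@[alpha] = 0); split.
- exists (fun f => f = map_mpoly iota q) => alpha.
  by split=> [q_alpha _ ->|]; last exact.
- have [c c0] := mpoly_nonroot q0; exists (iota \o c) => qc; case/eqP: c0.
  apply: (fmorph_inj iota); rewrite rmorph0 -[RHS]qc.
  rewrite mevalE [in RHS]/map_mpoly /mmap !raddf_sum; apply: eq_bigr => mon _ /=.
  rewrite rmorphM mevalM mevalC; congr (_ * _); rewrite /mmap1 !rmorph_prod.
  by apply: eq_bigr => i _; rewrite !rmorphXn /= mevalXU.
move=> alpha q_alpha; apply: Pq; apply/eqP=> q_alpha0; apply: q_alpha.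
by rewrite -eval_at_val (q_alpha0 : eval_at iota alpha q = 0) rmorph0.
Qed.

End AlmostAllPoints.

Lemma fmpoly_spec (k K : fieldType) (iota : {rmorphism k -> K}) m n
    (alpha : 'I_m -> K) (a : ratpoly k m n) (B : {mpoly {mpoly k[m]}[n]}) q :
  eval_at iota alpha q != 0 ->
  map_mpoly (@tofrac _) B = (tofrac q)%:MP * a ->
  is_specialization a
    ((eval_at iota alpha q)^-1 *: map_mpoly (eval_at iota alpha) B).
Proof.
move=> q_alpha BE; exists B, q; split=> //.
have q0 : tofrac q != 0.
  by rewrite tofrac_eq0; apply: contraNneq q_alpha => ->; rewrite raddf0.
by rewrite BE mul_mpolyC scalerA mulVf // scale1r.
Qed.

(** * Presentations cleared of denominators *)

Section ClearedPresentation.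
Variables (k K : fieldType) (iota : {rmorphism k -> K}) (m n : nat).
Local Notation X := (mpoly_family {mpoly k[m]} n).
Local Notation gen := (generic_pt {mpoly k[m]}).
Local Notation "B @ p" := (map_mx (fam_ev X p) B) (at level 30).
Variable D : presentation (ratpoly k m n).
Variables (q : {mpoly k[m]}) (B : 'M[X]_(rels D, gens D)).
Hypothesis BE : B@gen = fam_ev X gen (fam_cst X q) *: (rel_mx D : 'M[fam_fib X gen]_(_, _)).

Fact cleared_spec alpha i j : eval_at iota alpha q != 0 ->
  is_specialization (rel_mx D i j)
    ((eval_at iota alpha q)^-1 *: map_mpoly (eval_at iota alpha) (B i j)).
Proof.
move=> q_alpha; apply: fmpoly_spec => //.
have /matrixP/(_ i j) := BE; rewrite !mxE /= /mpoly_ev /= => ->.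
by rewrite map_mpolyC.
Qed.

Lemma cleared_spec_defined alpha : eval_at iota alpha q != 0 -> spec_defined iota alpha D.
Proof. by move=> q_alpha i j; eexists; apply: cleared_spec. Qed.

(** The specialized matrix is [B] at [alpha] divided by [q(alpha)], hence it has the same row
    space. *)
Lemma cleared_presents_spec alpha U : eval_at iota alpha q != 0 ->
  presents (spec_presentation iota alpha D) U ->
  presents (Presentation (B @ alpha_pt iota alpha)) U.
Proof.
move=> q_alpha; have -> : spec_presentation iota alpha D =
    Presentation (((eval_at iota alpha q)^-1)%:MP *: B @ alpha_pt iota alpha).
  congr Presentation; apply/matrixP=> i j.
  by rewrite !mxE (specE (cleared_spec i j q_alpha)) mul_mpolyC.
apply: presents_eq; first by apply: factorsZ; apply: factors_refl.
apply: (@factors_unit _ _ _ _ ((eval_at iota alpha q)^-1)%:MP (eval_at iota alpha q)%:MP).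
  by rewrite -mpolyCM divff.
exact: factors_refl.
Qed.

Lemma cleared_presents_generic U : q != 0 ->
  presents D U -> presents (Presentation (B@gen)) U.
Proof.
move=> q0; have [|u uq] := @fam_unit _ X gen q; first by rewrite tofrac_eq0.
rewrite BE; case: D B BE => g r rel B' BE' /=.
apply: presents_eq; last by apply: factorsZ; apply: factors_refl.
by apply: factors_unit uq _; apply: factors_refl.
Qed.

End ClearedPresentation.

(** Expresses vanishing as an inclusion of row spaces, so that it spreads from the generic point. *)
Lemma presents_zero (A : comNzRingType) r g (B : 'M[A]_(r, g)) (U : lmodType A) :
  presents (Presentation B) U -> zero_module U <-> factors 1%:M B.
Proof.
move=> [p [p_surj pP]]; split=> [U0|[C CE] x].
  apply: factors_rows => x; rewrite mulmx1; have /pP[y yE] := U0 (p x).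
  by exists y.
have [y <-] := p_surj x; apply/pP; exists (y *m C) => /=.
by rewrite -mulmxA -CE mulmx1.
Qed.

Theorem theorem4p2
    (k K : fieldType) (iota : {rmorphism k -> K})
    (k_infinite : forall s : seq k, exists c, c \notin s)
    (m n : nat)
    (L M : lmodType (ratpoly k m n))
    (DL DM : presentation (ratpoly k m n))
    (DL_presents : presents DL L) (DM_presents : presents DM M)
    (T : nat -> lmodType (ratpoly k m n))
    (T_Tor : forall i, is_Tor i L M (T i))
    (DT : nat -> presentation (ratpoly k m n))
    (DT_presents : forall i, presents (DT i) (T i))
    (* from some index on, one presentation is used for the zero module *)
    (i0 : nat)
    (DT_zero : forall i j, (i0 <= i)%N -> (i0 <= j)%N ->
       zero_module (T i) -> zero_module (T j) -> DT i = DT j) :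
  almost_all (fun alpha : 'I_m -> K =>
    [/\ spec_defined iota alpha DL,
        spec_defined iota alpha DM &
        forall i, spec_defined iota alpha (DT i) /\
          exists2 N : lmodType {mpoly (adjoin iota alpha)[n]},
            is_Tor i (coker (spec_presentation iota alpha DL))
                     (coker (spec_presentation iota alpha DM)) N &
            isomorphic (coker (spec_presentation iota alpha (DT i))) N]).
Proof.
pose X := mpoly_family {mpoly k[m]} n; pose gen := generic_pt {mpoly k[m]}.
have synX : syzygetic X := mpoly_syzygetic _ _.
pose cleared (D : presentation (ratpoly k m n)) q (B : 'M[X]_(rels D, gens D)) :=
  map_mx (fam_ev X gen) B = fam_ev X gen (fam_cst X q) *: (rel_mx D : 'M[fam_fib X gen]_(_, _)).
have clear D : exists2 q, q != 0 & exists B, @cleared D q B.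
  by have [q q0 [B BE]] := @clear_mx _ X _ _ (rel_mx D); exists q => //; exists B.
have [qL qL0 [BL BLE]] := clear DL; have [qM qM0 [BM BME]] := clear DM.
have presL := cleared_presents_generic BLE qL0 DL_presents.
have presM := cleared_presents_generic BME qM0 DM_presents.
have [d [TorG Tor0 TorG0]] := Tor_generically synX presL presM.
(* Below [i1] there are finitely many degrees, each with its own scalar. From [i1] on, the modules
   [T i] vanish and share one presentation. *)
pose i1 := maxn i0 d.+1.
have /choice[qT qTP] : forall i, exists q, q != 0 /\ exists B, @cleared (DT i) q B.
  by move=> i; have [q q0 [B BE]] := clear (DT i); exists q; split=> //; exists B.
have BTP i := cid (qTP i).2; pose BT i := sval (BTP i).
have BTE i : cleared (DT i) (qT i) (BT i) := svalP (BTP i).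
have presT i := cleared_presents_generic (BTE i) (qTP i).1 (DT_presents i).
have genTor : generically (fun p => forall i, (i < i1)%N ->
    forall L' M' T' : lmodType (fam_fib X p),
    presents (Presentation (map_mx (fam_ev X p) BL)) L' ->
    presents (Presentation (map_mx (fam_ev X p) BM)) M' ->
    presents (Presentation (map_mx (fam_ev X p) (BT i))) T' -> is_Tor i L' M' T').
  by apply: generically_forall => i _; apply: TorG (T_Tor i) (presT i).
(* The bound [i1.+1] includes [i1], whose presentation stands for all later ones. *)
have genT : generically (fun p => forall i, (i < i1.+1)%N -> pt_map p (qT i) != 0).
  by apply: generically_forall => i _; apply: generically_neq0; case: (qTP i).
have T0 i : (i1 <= i)%N -> zero_module (T i).
  by rewrite geq_max => /andP[_ lt_di]; apply: Tor0 (T_Tor i).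
have genT0 : generically (fun p => factors 1%:M (map_mx (fam_ev X p) (BT i1))).
  have : factors (map_mx (fam_ev X gen) 1%:M) (map_mx (fam_ev X gen) (BT i1)).
    by rewrite map_mx1; apply/(presents_zero (presT i1))/T0.
  by move/factors_generically; apply: generically_imp => p; rewrite map_mx1.
have /(generically_almost_all iota k_infinite) := generically_and
  (generically_and (generically_neq0 qL0) (generically_neq0 qM0))
  (generically_and (generically_and genTor genT) (generically_and TorG0 genT0)).
case=> V [Valg Vproper Vgood]; exists V; split=> // alpha /Vgood{Vgood}.
move=> [[qL_alpha qM_alpha] [[{}genTor {}genT] [{}TorG0 {}genT0]]].
have presLa := cleared_presents_spec BLE qL_alpha (presents_coker _).
have presMa := cleared_presents_spec BME qM_alpha (presents_coker _).
split; [exact: (cleared_spec_defined BLE qL_alpha) | exact: (cleared_spec_defined BME qM_alpha) |].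
have iso_refl (A : comNzRingType) (U : lmodType A) : isomorphic U U.
  by exists idfun; exists id.
move=> i; have [lt_i|le_i] := ltnP i i1.
  have qT_alpha := genT i (leqW lt_i); split; first exact: (cleared_spec_defined (BTE i) qT_alpha).
  exists (coker (spec_presentation iota alpha (DT i))); last exact: iso_refl.
  apply: genTor lt_i _ _ _ presLa presMa _.
  exact: (cleared_presents_spec (BTE i) qT_alpha (presents_coker _)).
have i0_i1 : (i0 <= i1)%N := leq_maxl _ _.
have -> : DT i = DT i1.
  by apply: DT_zero; rewrite ?(leq_trans i0_i1 le_i) //; apply: T0.
have qT_alpha := genT i1 (ltnSn i1); split; first exact: (cleared_spec_defined (BTE i1) qT_alpha).
exists (coker (spec_presentation iota alpha (DT i1))); last exact: iso_refl.
apply: TorG0 presLa presMa _ _ _ _; first exact: leq_trans (leq_maxr _ _) le_i.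
apply/(presents_zero (cleared_presents_spec (BTE i1) qT_alpha (presents_coker _))).
exact: genT0.
Qed.
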